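(* For any $n\in\mathbb{N}$ the polynomial $$F^{n}_{D}(t,\ell)=\sum_{c\in C(D)}\operatorname{sgn}(c)\,t^{\operatorname{Ind}(c)}\ell^{\nabla J_n(D_c)}-\sum_{c\in T_n(D)}\operatorname{sgn}(c)\,\ell^{\nabla J_n(D_c)}-\sum_{c\in C(D)\setminus T_n(D)}\operatorname{sgn}(c)\,\ell^{\nabla J_n(D)},$$ where $T_n(D)=\{c\in C(D)\mid \nabla J_n(D_c)=\pm\nabla J_n(D)\}$, is a virtual knot invariant; that is, if $D$ and $D'$ are two diagrams of the same oriented virtual knot $K$, then $F^n_D(t,\ell)=F^n_{D'}(t,\ell)$ (the common value is denoted $F^n_K(t,\ell)$).
   Context: $\mathbb{N}$ denotes the positive integers. A virtual knot diagram is a one-component planar knot diagram whose double points are either classical crossings (with over/under information) or virtual crossings. An oriented virtual knot is an equivalence class of oriented virtual knot diagrams under planar isotopy, the classical Reidemeister moves RI, RII, RIII, the virtual Reidemeister moves VRI, VRII, VRIII (the same moves with all crossings virtual), and the semi-virtual move SV (an arc with two consecutive virtual crossings is moved past a classical crossing). $C(D)$ is the set of classical crossings of $D$. Sign: draw a classical crossing $c$ with both strands oriented upward. Then $\operatorname{sgn}(c)=+1$ if the over-strand goes from bottom left to top right, and $\operatorname{sgn}(c)=-1$ if the over-strand goes from bottom right to top left. Index: an arc is an edge of $D$ between two consecutive classical crossings along the orientation. Label all arcs by integers so that labels are unchanged at virtual crossings and, at each classical crossing drawn with both strands oriented upward (whatever its sign), if the incoming arc on the left (bottom left) has label $a$ and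 the incoming arc on the right (bottom right) has label $b$, then the outgoing arc at top left has label $b+1$ and the outgoing arc at top right has label $a-1$. Such a labeling always exists: for example, label an arc $\alpha$ by $\lambda(\alpha)=\sum_{c\in O(\alpha)}\operatorname{sgn}(c)$, where $O(\alpha)$ is the set of classical crossings first met as overcrossings when traveling along the orientation starting from $\alpha$. Then $\operatorname{Ind}(c)=\operatorname{sgn}(c)(a-b-1)$. Dwrithe: for $n\in\mathbb{Z}\setminus\{0\}$, the $n$-th writhe is $J_n(D)=\sum_{c\in C(D),\,\operatorname{Ind}(c)=n}\operatorname{sgn}(c)$. For $n\in\mathbb{N}$ the $n$-th dwrithe is $\nabla J_n(D)=J_n(D)-J_{-n}(D)$. Smoothing against orientation: for $c\in C(D)$, $D_c$ is the oriented virtual knot diagram obtained by deleting $c$ and reconnecting so that (with both strands at $c$ oriented upward) the two top ends are joined to each other and the two bottom ends are joined to each other. The result is a one-component diagram, oriented as follows: the path of $D$ that leaves $c$ along the over-strand and returns to $c$ along the under-strand keeps its orientation, and the path that leaves $c$ along the under-strand and returns along the over-strand has its orientation reversed. *)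

(* Defs.v *)
From HB Require Import structures.
From mathcomp Require Import all_boot all_order all_algebra.
From mathcomp.multinomials Require Import monalg.
From Stdlib Require Import Relations.Relation_Operators.

Set Implicit Arguments.
Unset Strict Implicit.
Unset Printing Implicit Defensive.

Import GRing.Theory.
Local Open Scope ring_scope.

(** Oriented virtual knot diagrams in the plane, up to planar isotopy.

    Fix a base point on an edge that borders the unbounded face, and follow the
    knot from there: the word lists, in order, the passages through the double
    points, classical and virtual, each double point being passed twice.  The
    word determines the cyclic order of the four half-edges at every double
    point, hence the curve up to isotopy of the sphere; the side of the base
    edge on which the unbounded face lies then determines it up to isotopy of
    the plane. *)

Inductive level := Over | Under | Virt.

Definition level_code (l : level) : option bool :=
  match l with Over => Some true | Under => Some false | Virt => None end.
Definition level_decode (o : option bool) : level :=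
  match o with Some true => Over | Some false => Under | None => Virt end.
Lemma level_codeK : cancel level_code level_decode. Proof. by case. Qed.
HB.instance Definition _ := Equality.copy level (can_type level_codeK).

(** [ltr x]: when both strands at the double point are drawn upward, the strand
    followed by the passage [x] goes from bottom left to top right. *)
Record letter := Letter {name : nat; lev : level; ltr : bool}.

Definition letter_code (x : letter) := (name x, lev x, ltr x).
Definition letter_decode (u : nat * level * bool) := Letter u.1.1 u.1.2 u.2.
Lemma letter_codeK : cancel letter_code letter_decode. Proof. by case. Qed.
HB.instance Definition _ := Equality.copy letter (can_type letter_codeK).

Definition is_over (x : letter) : bool := lev x == Over.
Definition is_virt (x : letter) : bool := lev x == Virt.
Definition is_classical (x : letter) : bool := lev x != Virt.

Definition paired (x y : letter) : bool :=
  (ltr x != ltr y) &&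
  match lev x, lev y with
  | Over, Under | Under, Over | Virt, Virt => true
  | _, _ => false
  end.

Definition well_formed (w : seq letter) : bool :=
  all (fun x => if [seq y <- w | name y == name x] is [:: y; z]
                then paired y z else false) w.

(** Edges are indexed by ['I_(size w)]: edge [i] ends at the [i]-th passage,
    and edge [0] carries the base point. *)

Definition passage (w : seq letter) (i : 'I_(size w)) : letter :=
  tnth (in_tuple w) i.

Definition mate (w : seq letter) (i : 'I_(size w)) : 'I_(size w) :=
  odflt i [pick j | (j != i) && (name (passage j) == name (passage i))].

(** A dart [(i, s)] is edge [i] followed forward if [s], backward otherwise; it
    stands for the face on the left of the traveller, i.e. on the left ([s]) or
    right ([~~ s]) of the oriented edge [i].  The next dart of the same face is
    obtained by turning left at the double point that is reached. *)
Definition next_dart (w : seq letter) (d : 'I_(size w) * bool) :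
    'I_(size w) * bool :=
  let: (i, s) := d in
  let k := if s then i else ord_pred i in
  if ltr (passage k) == s then (ordS (mate k), true) else (mate k, false).

(** Euler's formula V - E + F = 2 with 2 V = E = size w; the trivial diagram
    has no dart. *)
Definition planar (w : seq letter) : bool :=
  nilp w || ((fcard (@next_dart w) predT).*2 == (size w + 4)%N).

(** [outer]: the unbounded face is on the left of the base edge. *)
Record diagram := Diagram {
  word : seq letter;
  outer : bool;
  word_well_formed : well_formed word;
  word_planar : planar word }.

(** A segment [p = (p.1, p.2)] is an edge joining two consecutive
    passages.  A face is walked around with the face on the left, each segment
    being followed forward or backward according to a boolean. *)

Definition finish (d : bool) (p : letter * letter) := if d then p.2 else p.1.
Definition start (d : bool) (p : letter * letter) := if d then p.1 else p.2.

(** Turning left from [p] (followed along [d]) into [q] (followed along [e]);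
    this agrees with [next_dart]. *)
Definition corner (d e : bool) (p q : letter * letter) : bool :=
  (name (finish d p) == name (start e q)) &&
  (ltr (finish d p) == (d == e)).

Definition monogon (p : letter * letter) : Prop :=
  exists d, corner d d p p.

Definition bigon (p q : letter * letter) : Prop :=
  exists d e, corner d e p q /\ corner e d q p.

Definition triangle (p q r : letter * letter) : Prop :=
  exists d e f, [/\ corner d e p q, corner e f q r & corner f d r p].

Definition both (P : pred letter) (p : letter * letter) : bool :=
  P p.1 && P p.2.

Definition seg (p : letter * letter) : seq letter := [:: p.1; p.2].
Definition swap (p : letter * letter) : letter * letter := (p.2, p.1).

(** In each of the three patterns the base edge, hence the unbounded face, lies
    outside of the disk where the move takes place. *)

Definition adds_monogon (p : letter * letter) (D D' : diagram) : Prop :=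
  monogon p /\ outer D' = outer D /\
  exists u v, word D = u ++ v /\ word D' = u ++ seg p ++ v.

Definition adds_bigon (p q : letter * letter) (D D' : diagram) : Prop :=
  bigon p q /\ outer D' = outer D /\
  exists u v w, word D = u ++ v ++ w /\
                word D' = u ++ seg p ++ v ++ seg q ++ w.

Definition flips_triangle (p q r : letter * letter) (D D' : diagram) : Prop :=
  (triangle p q r \/ triangle p r q) /\ outer D' = outer D /\
  exists u v w z,
    word D = u ++ seg p ++ v ++ seg q ++ w ++ seg r ++ z /\
    word D' = u ++ seg (swap p) ++ v ++ seg (swap q) ++ w ++ seg (swap r) ++ z.

Definition rename (f : nat -> nat) (x : letter) : letter :=
  Letter (f (name x)) (lev x) (ltr x).

(** The first two clauses identify the words of one and the same plane diagram
    (another naming of the double points, another base point on the boundary of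
    the unbounded face). *)
Inductive move (D D' : diagram) : Prop :=
| Rename (f : nat -> nat) of injective f &
    word D' = map (rename f) (word D) & outer D' = outer D
| Rebase (b e : 'I_(size (word D))) of val b = 0%N &
    word D' = rot e (word D) &
    fconnect (@next_dart (word D)) (b, outer D) (e, outer D')
| RI p of adds_monogon p D D' & both is_classical p
| RII p q of adds_bigon p q D D' & both is_over p || both is_over q
| RIII p q r of flips_triangle p q r D D' &
    [&& both is_classical p, both is_classical q & both is_classical r] &
    [|| both is_over p, both is_over q | both is_over r]
| VRI p of adds_monogon p D D' & both is_virt p
| VRII p q of adds_bigon p q D D' & both is_virt p && both is_virt q
| VRIII p q r of flips_triangle p q r D D' &
    [&& both is_virt p, both is_virt q & both is_virt r]
(* exactly one of the three crossings of the triangle is classical *)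
| SV p q r of flips_triangle p q r D D' &
    [|| both is_virt p && ~~ both is_virt q,
        both is_virt q && ~~ both is_virt r
      | both is_virt r && ~~ both is_virt p].

Definition same_virtual_knot : diagram -> diagram -> Prop :=
  clos_refl_sym_trans diagram move.

Definition classical (w : seq letter) : seq nat :=
  [seq name x | x <- w & is_over x].

Definition csign (w : seq letter) (c : nat) : int :=
  if has (fun x => [&& name x == c, is_over x & ltr x]) w then 1 else -1.

(** At a classical crossing the label decreases by one along the strand from
    bottom left to top right and increases by one along the other strand. *)
Definition step (x : letter) : int :=
  if is_virt x then 0 else if ltr x then -1 else 1.

Definition labeling (w : seq letter) (lam : nat -> int) : Prop :=
  forall i : 'I_(size w), lam (ordS i) = lam i + step (passage i).

Definition label (w : seq letter) (i : nat) : int :=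
  \sum_(x <- take i w) step x.

(** The edges at the bottom left and at the bottom right of [c]. *)
Definition in_left (w : seq letter) (c : nat) : nat :=
  find (fun x => (name x == c) && ltr x) w.
Definition in_right (w : seq letter) (c : nat) : nat :=
  find (fun x => (name x == c) && ~~ ltr x) w.

(** [label] is a labeling ([label_labeling]) and any other one gives the same
    index ([crossing_index_labeling]). *)
Definition crossing_index (w : seq letter) (c : nat) : int :=
  csign w c * (label w (in_left w c) - label w (in_right w c) - 1).

Definition writhe (w : seq letter) (n : int) : int :=
  \sum_(c <- classical w | crossing_index w c == n) csign w c.

Definition dwrithe (w : seq letter) (n : nat) : int :=
  writhe w n%:Z - writhe w (- n%:Z).

(** Reversing the strands in [r]: the two strands at a double point exchange
    left and right exactly when one of them, but not the other, is reversed. *)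
Definition reorient (r : seq letter) (x : letter) : letter :=
  Letter (name x) (lev x)
    (ltr x (+) (count (fun y => name y == name x) r == 1%N)).

(** With [w = p ++ x :: q ++ y :: r] and [x], [y] the two passages through [c]:
    if [x] is the overpassage, the path from over to under is [q] and the path
    from under to over is [r ++ p] (through the base point), which is reversed;
    otherwise [q] is reversed.  The base point is kept; the side of the
    unbounded face is not recorded, the indices and writhes do not use it. *)
Definition smooth (w : seq letter) (c : nat) : seq letter :=
  let at_c x := name x == c in
  let p := take (find at_c w) w in
  let s := drop (find at_c w).+1 w in
  let q := take (find at_c s) s in
  let r := drop (find at_c s).+1 s in
  if has (fun x => at_c x && is_over x) (take (find at_c w).+1 w)
  then map (reorient (r ++ p)) (rev r ++ q ++ rev p)
  else map (reorient q) (p ++ rev q ++ r).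

(** Integer Laurent polynomials in [t] and [l]: the free abelian group on the
    monomials [t ^ i * l ^ j], encoded as the pairs [(i, j)]. *)
Definition laurent := {malg int[(int * int)%type]}.

Definition monomial (a i j : int) : laurent := << a *g (i, j) >>.

Definition in_T (n : nat) (w : seq letter) (c : nat) : bool :=
  (dwrithe (smooth w c) n == dwrithe w n) ||
  (dwrithe (smooth w c) n == - dwrithe w n).

Definition Fpoly (n : nat) (D : diagram) : laurent :=
  let w := word D in
  \sum_(c <- classical w)
     monomial (csign w c) (crossing_index w c) (dwrithe (smooth w c) n)
  - \sum_(c <- classical w | in_T n w c)
     monomial (csign w c) 0 (dwrithe (smooth w c) n)
  - \sum_(c <- classical w | ~~ in_T n w c)
     monomial (csign w c) 0 (dwrithe w n).

Lemma well_formedP (w : seq letter) (x : letter) :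
  well_formed w -> x \in w ->
  exists y z, [seq u <- w | name u == name x] = [:: y; z] /\ paired y z.
Proof.
move=> /allP wf /wf; case: filter => [|y [|z []]] // yz.
by exists y, z.
Qed.

Lemma sum_step_eq0 (w : seq letter) :
  well_formed w -> \sum_(x <- w) step x = 0.
Proof.
move=> wf; set s := undup (map name w).
have -> : \sum_(x <- w) step x =
    \sum_(x <- w) \sum_(c <- s | name x == c) step x.
  rewrite big_seq [RHS]big_seq; apply: eq_bigr => x xw.
  rewrite (eq_bigl (fun c => c == name x)) => [|c]; last exact: eq_sym.
  by rewrite -big_filter filter_pred1_uniq ?undup_uniq ?mem_undup ?map_f // big_seq1.
rewrite (exchange_big_dep predT) //= big_seq big1 // => c.
rewrite mem_undup => /mapP[x xw ->]; rewrite -big_filter.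
have [y [z [-> /andP[]]]] := well_formedP wf xw.
rewrite !big_cons big_nil /step /is_virt.
by case: (ltr y) (ltr z) (lev y) (lev z) => [] [] [] [].
Qed.

Lemma label_labeling (w : seq letter) : well_formed w -> labeling w (label w).
Proof.
move=> wf i; have iw := ltn_ord i.
have -> : label w i + step (passage i) = label w i.+1.
  rewrite /label (take_nth (passage i)) // -cats1 big_cat big_seq1 /=.
  by congr (_ + step _); rewrite {1}/passage (tnth_nth (passage i)).
rewrite /=; case: (ltngtP i.+1 (size w)) iw => // [lt_i|ei] _.
  by rewrite modn_small.
by rewrite ei modnn /label take0 big_nil take_size sum_step_eq0.
Qed.

Lemma crossing_index_labeling (w : seq letter) (lam : nat -> int) (c : nat) :
  well_formed w -> labeling w lam -> c \in classical w ->
  crossing_index w c =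
  csign w c * (lam (in_left w c) - lam (in_right w c) - 1).
Proof.
move=> wf lamP /mapP[x]; rewrite mem_filter => /andP[_ xw] ->{c}.
have lamE i : (i < size w)%N -> lam i = lam 0%N + label w i.
  elim: i => [|i IH] ltiw; first by rewrite /label take0 big_nil addr0.
  have := label_labeling wf (Ordinal (ltnW ltiw)).
  have := lamP (Ordinal (ltnW ltiw)); rewrite /= modn_small // => -> ->.
  by rewrite IH ?addrA // ltnW.
have [y [z [e /andP[yz _]]]] := well_formedP wf xw.
have [yw zw] : (y \in w) && (name y == name x) /\ (z \in w) && (name z == name x).
  have : (y \in [:: y; z]) && (z \in [:: y; z]) by rewrite !inE !eqxx orbT.
  by rewrite -e !mem_filter => /andP[/andP[-> ->] /andP[-> ->]].
have lt b : (find (fun u => (name u == name x) && (ltr u == b)) w < size w)%N.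
  rewrite -has_find; apply/hasP.
  case/andP: yw => yw ny; case/andP: zw => zw nz.
  have [yb|yb] := eqVneq (ltr y) b; first by exists y; rewrite ?ny ?yb ?eqxx.
  exists z => //; rewrite nz /=.
  by move: yz yb; case: (ltr y); case: (ltr z); case: b.
rewrite /crossing_index (lamE (in_left w (name x))) ?(lamE (in_right w (name x))).
- by rewrite opprD addrACA subrr add0r.
- rewrite /in_right (eq_find (a2 := fun u => (name u == name x) && (ltr u == false))) //.
  by move=> u; rewrite /= eqbF_neg.
- rewrite /in_left (eq_find (a2 := fun u => (name u == name x) && (ltr u == true))) //.
  by move=> u; rewrite /= eqb_id.
Qed.

(* Main.v *)
Require Import Defs.
From mathcomp Require Import all_boot all_order all_algebra zify.
From mathcomp.multinomials Require Import monalg.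

(** The polynomial only sees the classical letters of the word, and of each of
    them only the crossing and the side: call [flat w] the list of the pairs
    (name, [ltr]) of the classical letters.  Write [bar x] for the other passage
    through the crossing of [x].  Since jump functions
    [[i = n] - [i = - n]] are odd in [i], the sign of a crossing cancels out of
    its contribution to the dwrithe, which is therefore a function [fdwrithe] of
    the flat word alone: over and under no longer matter ([dwritheE]).

    Rotating the word so that it reads [x q (bar x) r], with [x] the
    overpassage, the smoothing at [x] is, up to rotation, [q] followed by the
    reversed [r], where the side of a passage is exchanged when its crossing has
    exactly one passage in [r] ([fsmooth], [dwrithe_smooth]).  Hence [Fpoly] is
    a sum over the overpassages of terms that only depend on the overpassage and
    on the flat word ([FpolyE]).  The moves that involve a virtual crossing do
    not change the flat word.

    [fdwrithe] is invariant under rotation, renaming, insertion of a monogon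
    ([fdwrithe_monogon]) or of a bigon ([fdwrithe_bigon]) and under the flip of
    a triangle ([fdwrithe_tri]); it changes sign when the word is reversed
    ([fdwrithe_rev]).  All these follow from the effect of a local replacement
    on the labels.  The smoothing at a crossing outside of the move turns a move
    into a move of the same kind, possibly with some strands reversed
    ([subst1_fsmooth]), so the corresponding term is unchanged.

    The crossings of the move itself remain.
    - For a monogon, the smoothed word is the rest of the word or its reverse,
      so its dwrithe is that of the diagram up to sign, and the index is 0: the
      term vanishes ([Fflat_monogon]).
    - For a bigon, the two crossings have equal indices, opposite signs, and
      smoothings of equal dwrithe.  If the strands are parallel, the other
      crossing becomes a monogon in each smoothing and both reduce to the same
      word; if they are antiparallel, the two smoothings agree up to exchanging
      the names of the two crossings ([fdwrithe_fsmooth_bigon_self]).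
    - For a triangle, the indices are kept, and the smoothings at a crossing
      before and after the move either both reduce to the same word by removing
      a bigon formed by the other two crossings, or agree up to exchanging the
      names of these two ([fdwrithe_fsmooth_tri_parallel],
      [fdwrithe_fsmooth_tri_antiparallel]). *)

Set Implicit Arguments.
Unset Strict Implicit.
Unset Printing Implicit Defensive.

Import GRing.Theory.
Local Open Scope ring_scope.

(** * Flat words and their dwrithe *)

(** A classical passage without its level: the name of the crossing, and whether
    the strand goes from bottom left to top right. *)
Definition fletter := (nat * bool)%type.

(** The other passage through the same crossing. *)
Definition bar (x : fletter) : fletter := (x.1, ~~ x.2).

(** The change of the label along the strand. *)
Definition fstep (x : fletter) : int := if x.2 then -1 else 1.
Definition ftotal (k : seq fletter) : int := \sum_(x <- k) fstep x.

(** The label of the edge that ends at the passage [x], the base edge having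
    label 0. *)
Definition flabel (k : seq fletter) (x : fletter) : int :=
  ftotal (take (index x k) k).

(** The index of the crossing [c] up to its sign: [a - b - 1] where [a] and [b]
    are the labels of the incoming edges at the left and at the right. *)
Definition chord_index (k : seq fletter) (c : nat) : int :=
  flabel k (c, true) - flabel k (c, false) - 1.

(** The contribution to the [n]-th dwrithe of a positive crossing of index [i].
    It is odd in [i]. *)
Definition jump (n : nat) (i : int) : int :=
  (i == n%:Z)%:R - (i == - n%:Z)%:R.

(** The [n]-th dwrithe of a flat word.  The signs do not occur: a negative
    crossing has index [- i] for [i] its [chord_index], and contributes
    [- jump n (- i) = jump n i]. *)
Definition fdwrithe (n : nat) (k : seq fletter) : int :=
  \sum_(x <- k | x.2) jump n (chord_index k x.1).

(** The two passages through each crossing occur, once each. *)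
Definition flat_wf (k : seq fletter) : bool :=
  uniq k && all (fun x => bar x \in k) k.

Lemma barK : involutive bar.
Proof. by case=> c b; rewrite /bar negbK. Qed.

Lemma bar_neq x : (bar x == x) = false.
Proof. by case: x => c [] /=; rewrite xpair_eqE andbF. Qed.

Lemma neq_bar x : (x == bar x) = false.
Proof. by rewrite eq_sym bar_neq. Qed.

Lemma eq_name (x y : fletter) : (x.1 == y.1) = (x == y) || (x == bar y).
Proof.
case: x y => [c b] [d e]; rewrite !xpair_eqE /=.
by case: eqP => //= _; case: b e => [] [].
Qed.

Lemma fstep_bar x : fstep (bar x) = - fstep x.
Proof. by case: x => c []; rewrite /fstep /= ?opprK. Qed.

Lemma jumpN n i : jump n (- i) = - jump n i.
Proof. by rewrite /jump eqr_opp opprB eqr_oppLR. Qed.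

Lemma jump0 n : jump n 0 = 0.
Proof.
rewrite /jump; have -> : (0 == - n%:Z) = (0 == n%:Z) by lia.
by rewrite subrr.
Qed.

Lemma ftotal_cat u v : ftotal (u ++ v) = ftotal u + ftotal v.
Proof. exact: big_cat. Qed.

Lemma ftotal_cons x v : ftotal (x :: v) = fstep x + ftotal v.
Proof. exact: big_cons. Qed.

Lemma ftotal_nil : ftotal [::] = 0. Proof. exact: big_nil. Qed.

Lemma ftotal_perm u v : perm_eq u v -> ftotal u = ftotal v.
Proof. exact: perm_big. Qed.

Lemma ftotal_rev u : ftotal (rev u) = ftotal u.
Proof. by apply: ftotal_perm; rewrite perm_rev. Qed.

Definition ftotalE := (ftotal_cat, ftotal_cons, ftotal_nil, ftotal_rev).

Lemma flabel_cat u v x :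
  flabel (u ++ v) x = if x \in u then flabel u x else ftotal u + flabel v x.
Proof.
rewrite /flabel index_cat; case: ifP => xu.
  by rewrite take_cat index_mem xu.
by rewrite take_cat ltnNge leq_addr /= addKn ftotal_cat.
Qed.

Lemma flabel_cons y k x : flabel (y :: k) x = if y == x then 0 else fstep y + flabel k x.
Proof.
by rewrite /flabel /=; case: eqP => _; rewrite ?take0 ?ftotal_nil //= ftotal_cons.
Qed.

Lemma flabel_mid u x v : x \notin u -> flabel (u ++ x :: v) x = ftotal u.
Proof. by move=> xu; rewrite flabel_cat (negPf xu) flabel_cons eqxx addr0. Qed.

Lemma uniq_mid (T : eqType) (u v : seq T) x :
  uniq (u ++ x :: v) -> x \notin u /\ x \notin v.
Proof.
rewrite cat_uniq /= negb_or => /and3P[_ /andP[xu _] /andP[xv _]].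
by split.
Qed.

Lemma flat_wf_uniq k : flat_wf k -> uniq k. Proof. by case/andP. Qed.

Lemma mem_bar k x : flat_wf k -> (bar x \in k) = (x \in k).
Proof.
case/andP=> _ /allP h; apply/idP/idP => /h //.
by rewrite barK.
Qed.

Lemma flat_wf_perm k k' : perm_eq k k' -> flat_wf k = flat_wf k'.
Proof.
move=> h; rewrite /flat_wf (perm_uniq h) (perm_all _ h); congr (_ && _).
by apply: eq_all => x; rewrite (perm_mem h).
Qed.

Lemma mem_ends k x b : flat_wf k -> x \in k -> (x.1, b) \in k.
Proof.
move=> wf; case: x => c d xk /=.
have [->|ne] := eqVneq b d; first by [].
have -> : (c, b) = bar (c, d) by case: b d ne {xk} => [] [].
by rewrite mem_bar.
Qed.

(** The two steps at each crossing cancel. *)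
Lemma ftotal_wf k : flat_wf k -> ftotal k = 0.
Proof.
move=> wf; have : ftotal k = ftotal (map bar k).
  apply: ftotal_perm; apply: uniq_perm.
  - exact: flat_wf_uniq.
  - by rewrite (map_inj_uniq (inv_inj barK)) flat_wf_uniq.
  - move=> x; rewrite -{2}[x]barK (mem_map (inv_inj barK)).
    by rewrite mem_bar.
rewrite {2}/ftotal big_map (eq_bigr (fun x => - fstep x)) => [|x _]; last first.
  exact: fstep_bar.
by rewrite sumrN -/(ftotal k); lia.
Qed.

Lemma fdwrithe_perm n k k' : perm_eq k k' ->
  (forall x, x \in k -> chord_index k x.1 = chord_index k' x.1) -> fdwrithe n k = fdwrithe n k'.
Proof.
move=> p h; rewrite /fdwrithe -(perm_big _ p) /= big_seq_cond [RHS]big_seq_cond.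
by apply: eq_bigr => x /andP[/h -> _].
Qed.

Lemma flabel_rot u v x : flat_wf (u ++ v) -> x \in u ++ v ->
  flabel (v ++ u) x = flabel (u ++ v) x + ftotal v.
Proof.
move=> wf; rewrite mem_cat !flabel_cat => xin.
have := ftotal_wf wf; rewrite ftotal_cat => tot.
have := flat_wf_uniq wf; rewrite cat_uniq => /and3P[_ /hasPn h _].
have [xv|xv] := boolP (x \in v).
  by rewrite (negPf (h _ xv)); lia.
by move: xin; rewrite (negPf xv) orbF => ->; lia.
Qed.

Lemma chord_index_rot u v x : flat_wf (u ++ v) -> x \in u ++ v ->
  chord_index (v ++ u) x.1 = chord_index (u ++ v) x.1.
Proof.
by move=> wf xin; rewrite /chord_index !(flabel_rot wf) ?mem_ends //; lia.
Qed.

Lemma fdwrithe_rot n u v : flat_wf (u ++ v) -> fdwrithe n (v ++ u) = fdwrithe n (u ++ v).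
Proof.
move=> wf; apply: fdwrithe_perm; first by rewrite perm_catC.
by move=> x xin; apply: chord_index_rot => //; rewrite mem_cat orbC -mem_cat.
Qed.

Lemma flabel_rev k x : uniq k -> x \in k ->
  flabel (rev k) x = ftotal k - flabel k x - fstep x.
Proof.
move=> un xk; move: un; case/splitPr: xk => u v /uniq_mid[xu xv].
rewrite flabel_mid // rev_cat rev_cons -cats1 -catA /= flabel_mid ?mem_rev //.
by rewrite !ftotalE; lia.
Qed.

Lemma chord_index_rev k x : flat_wf k -> x \in k ->
  chord_index (rev k) x.1 = - chord_index k x.1.
Proof.
move=> wf xin; rewrite /chord_index !flabel_rev ?mem_ends ?flat_wf_uniq //.
by rewrite /fstep /=; lia.
Qed.

Lemma fdwrithe_rev n k : flat_wf k -> fdwrithe n (rev k) = - fdwrithe n k.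
Proof.
move=> wf; rewrite /fdwrithe (perm_big k) ?perm_rev //= -sumrN big_seq_cond.
rewrite [RHS]big_seq_cond; apply: eq_bigr => x /andP[xk _].
by rewrite chord_index_rev // jumpN.
Qed.

(** Renaming of the crossings. *)
Definition ren (f : nat -> nat) (x : fletter) : fletter := (f x.1, x.2).

Lemma ren_inj f : injective f -> injective (ren f).
Proof. by move=> fi [c b] [d e] [/fi -> ->]. Qed.

Lemma ftotal_ren f k : ftotal (map (ren f) k) = ftotal k.
Proof. by rewrite /ftotal big_map. Qed.

Lemma flabel_ren f k x : injective f -> flabel (map (ren f) k) (ren f x) = flabel k x.
Proof.
by move=> fi; rewrite /flabel index_map ?ftotal_ren -?map_take ?ftotal_ren //; exact: ren_inj.
Qed.

Lemma chord_index_ren f k c : injective f ->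
  chord_index (map (ren f) k) (f c) = chord_index k c.
Proof.
move=> fi; rewrite /chord_index.
by rewrite -[(f c, true)]/(ren f (c, true)) -[(f c, false)]/(ren f (c, false)) !flabel_ren.
Qed.

Lemma fdwrithe_ren n f k : injective f -> fdwrithe n (map (ren f) k) = fdwrithe n k.
Proof.
by move=> fi; rewrite /fdwrithe big_map; apply: eq_bigr => x _; rewrite /= chord_index_ren.
Qed.

(** [k'] is obtained from [k] by replacing one occurrence of the factor [s] by
    [s']. *)
Definition subst1 (s s' k k' : seq fletter) : Prop :=
  exists u v, k = u ++ s ++ v /\ k' = u ++ s' ++ v.

(** Inserting two passages of opposite steps changes no other label. *)
Lemma flabel_ins x y k k' z : subst1 [::] [:: x; y] k k' ->
  x.2 != y.2 -> z != x -> z != y -> flabel k' z = flabel k z.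
Proof.
move=> [u [v [-> ->]]] h zx zy; rewrite /= !flabel_cat !flabel_cons.
rewrite ![_ == z]eq_sym (negPf zx) (negPf zy).
case: ifP => // _; move: h; rewrite /fstep; case: (x.2) (y.2) => [] [] // _; lia.
Qed.

Lemma chord_index_ins x y k k' c : subst1 [::] [:: x; y] k k' ->
  x.2 != y.2 -> c != x.1 -> c != y.1 -> chord_index k' c = chord_index k c.
Proof.
move=> h ne cx cy; have nx b : (c, b) != x by apply: contraNneq cx => <-.
have ny b : (c, b) != y by apply: contraNneq cy => <-.
by rewrite /chord_index !(flabel_ins h).
Qed.

Lemma flabel_adj x y k k' : subst1 [::] [:: x; y] k k' -> uniq k' ->
  flabel k' y = flabel k' x + fstep x.
Proof.
move=> [u [v [_ ->]]] /= un; rewrite !flabel_cat !flabel_cons eqxx.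
have [xu] := uniq_mid un; rewrite inE negb_or => /andP[xy _].
have [] : y \notin rcons u x /\ y \notin v by apply: uniq_mid; rewrite cat_rcons.
rewrite mem_rcons inE negb_or => /andP[_ yu] _.
by rewrite (negPf xu) (negPf yu) (negPf xy) eqxx; lia.
Qed.

Lemma subst1_perm s s' k k' t : subst1 s s' k k' ->
  perm_eq s' (t ++ s) -> perm_eq k' (t ++ k).
Proof.
move=> [u [v [-> ->]]] h.
rewrite perm_sym perm_catCA perm_cat2l catA perm_cat2r perm_sym //.
Qed.

Lemma chord_index_monogon y k k' : subst1 [::] [:: y; bar y] k k' -> uniq k' ->
  chord_index k' y.1 = 0.
Proof.
move=> h un; have := flabel_adj h un; rewrite /chord_index; case: y {h} => c [];
by rewrite /bar /= => ->; rewrite /fstep /=; lia.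
Qed.

Lemma fdwrithe_monogon n y k k' : subst1 [::] [:: y; bar y] k k' -> uniq k' ->
  fdwrithe n k' = fdwrithe n k.
Proof.
move=> h un; have p : perm_eq k' ([:: y; bar y] ++ k).
  by apply: (subst1_perm h); rewrite cats0.
have := un; rewrite (perm_uniq p) /= inE negb_or => /and3P[/andP[_ yk] byk unk].
rewrite /fdwrithe (perm_big _ p) /= !big_cons /=.
have -> : \sum_(x <- k | x.2) jump n (chord_index k' x.1) = fdwrithe n k.
  rewrite /fdwrithe big_seq_cond [RHS]big_seq_cond; apply: eq_bigr => x /andP[xk _].
  have ne : x.1 != y.1.
    rewrite eq_name negb_or; apply/andP.
    by split; [apply: contraNneq yk|apply: contraNneq byk] => <-.
  by rewrite (chord_index_ins h) //=; case: (y.2).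
by rewrite (chord_index_monogon h un) jump0; case: (y.2); rewrite /= ?add0r ?addr0.
Qed.

(** The pair [x, y] in this order if [o], in the other order otherwise. *)
Definition ord2 (T : Type) (o : bool) (x y : T) : seq T :=
  if o then [:: x; y] else [:: y; x].

(** A bigon is inserted in two steps, one strand after the other: the
    intermediate word [k1] contains only one passage through each of the two
    crossings. *)
Lemma bigon_perm p1 p2 o k0 k1 k2 :
  subst1 [::] [:: p1; p2] k0 k1 ->
  subst1 [::] (ord2 o (bar p1) (bar p2)) k1 k2 ->
  perm_eq k1 ([:: p1; p2] ++ k0) /\
  perm_eq k2 ([:: p1; p2; bar p1; bar p2] ++ k0).
Proof.
move=> h1 h2; have pm1 : perm_eq k1 ([:: p1; p2] ++ k0).
  by apply: (subst1_perm h1); rewrite cats0.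
split=> //; have pm2 : perm_eq k2 ([:: bar p1; bar p2] ++ k1).
  apply: (subst1_perm h2); rewrite cats0; case: (o) => //=.
  by rewrite (perm_catC [:: bar p2] [:: bar p1]).
apply: (perm_trans pm2).
rewrite -[_ ++ k0]/([:: p1; p2] ++ [:: bar p1; bar p2] ++ k0).
by rewrite perm_sym perm_catCA perm_cat2l perm_sym.
Qed.

Lemma bigon_uniq p1 p2 o k0 k1 k2 :
  subst1 [::] [:: p1; p2] k0 k1 ->
  subst1 [::] (ord2 o (bar p1) (bar p2)) k1 k2 ->
  uniq k2 -> uniq k1.
Proof.
move=> h1 h2; have [pm1 pm] := bigon_perm h1 h2.
rewrite (perm_uniq pm) (perm_uniq pm1).
rewrite -[_ ++ k0]/([:: p1; p2] ++ [:: bar p1; bar p2] ++ k0).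
by rewrite (perm_uniq (permEl (perm_catCA _ _ _))) cat_uniq => /and3P[].
Qed.

(** The labels at one crossing of a bigon are those at the other one, shifted by
    the steps along the edges of the bigon. *)
Lemma chord_index_bigon p1 p2 o k0 k1 k2 :
  subst1 [::] [:: p1; p2] k0 k1 ->
  subst1 [::] (ord2 o (bar p1) (bar p2)) k1 k2 ->
  p1.2 != p2.2 -> uniq k2 -> p1.1 != p2.1 /\ chord_index k2 p2.1 = - chord_index k2 p1.1.
Proof.
move=> h1 h2 ne un; have [pm1 pm] := bigon_perm h1 h2.
have un1 := bigon_uniq h1 h2 un.
have [c1 [c2 [b [e1 e2 cc]]]] : exists c1 c2 b,
    [/\ p1 = (c1, b), p2 = (c2, ~~ b) & c1 != c2].
  exists p1.1, p2.1, p1.2; split; first by case: (p1).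
    by case: p2 ne {h1 h2 pm1 pm} => c2 b2 /=; case: (p1.2) b2 => [] [].
  rewrite eq_name; apply/negP => /orP[/eqP e|/eqP e].
    by rewrite e eqxx in ne.
  by move: un; rewrite (perm_uniq pm) /= !inE e eqxx !orbT.
subst p1 p2; split=> //=.
have adj1 : flabel k2 (c2, ~~ b) = flabel k2 (c1, b) + fstep (c1, b).
  have := flabel_adj h1 un1; case: (o) h2 => h2; rewrite -!(flabel_ins h2) //;
    rewrite ?xpair_eqE /= ?(negPf cc) ?[c2 == c1]eq_sym ?(negPf cc) ?eqxx //=;
    by case: (b).
move: h2 adj1; rewrite /chord_index /ord2 /bar /= negbK.
by case: (o) => h2; have := flabel_adj h2 un; rewrite /fstep /=;
  case: (b) => /= -> ->; lia.
Qed.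

Lemma fdwrithe_bigon n p1 p2 o k0 k1 k2 :
  subst1 [::] [:: p1; p2] k0 k1 ->
  subst1 [::] (ord2 o (bar p1) (bar p2)) k1 k2 ->
  p1.2 != p2.2 -> uniq k2 -> fdwrithe n k2 = fdwrithe n k0.
Proof.
move=> h1 h2 ne un; have [_ pm] := bigon_perm h1 h2.
have [cc opp] := chord_index_bigon h1 h2 ne un.
rewrite {1}/fdwrithe (perm_big _ pm) /= !big_cons /= opp jumpN.
have -> : \sum_(x <- k0 | x.2) jump n (chord_index k2 x.1) = fdwrithe n k0.
  rewrite /fdwrithe big_seq_cond [RHS]big_seq_cond; apply: eq_bigr => x /andP[xk _].
  have : x \notin [:: p1; p2; bar p1; bar p2].
    apply: contraL (un); rewrite (perm_uniq pm) cat_uniq => xi.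
    by apply/nandP; right; rewrite negb_and negbK; apply/orP; left; apply/hasP; exists x.
  rewrite !inE !negb_or => /and4P[n1 n2 n3 n4].
  have x1 : x.1 != p1.1 by rewrite eq_name negb_or n1.
  have x2 : x.1 != p2.1 by rewrite eq_name negb_or n2.
  rewrite -(chord_index_ins h1) //.
  by case: (o) h2 => h2; rewrite (chord_index_ins h2) //=; move: ne;
    case: (p1.2) (p2.2) => [] [].
by move: ne; case: (p1.2) (p2.2) => [] [] //= _; lia.
Qed.

(** The change of the label of [z] when the adjacent passages [x], [y], in this
    order, are exchanged. *)
Definition shift (x y z : fletter) : int :=
  if z == x then fstep y else if z == y then - fstep x else 0.

Lemma flabel_swap x y k k' z : subst1 [:: x; y] [:: y; x] k k' -> uniq k ->
  flabel k' z = flabel k z + shift x y z.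
Proof.
move=> [u [v [-> ->]]] /= un; rewrite !flabel_cat !flabel_cons /shift.
have [xu] := uniq_mid un; rewrite inE negb_or => /andP[xy _].
have [] : y \notin rcons u x /\ y \notin v by apply: uniq_mid; rewrite cat_rcons.
rewrite mem_rcons inE negb_or => /andP[_ yu] _.
rewrite ![_ == z]eq_sym.
have [->|zx] := eqVneq z x; first by rewrite (negPf xu) (negPf xy); lia.
have [->|zy] := eqVneq z y; first by rewrite (negPf yu); lia.
by case: ifP; lia.
Qed.

Lemma flabel_ord2 o x y k k' z : subst1 (ord2 o x y) (ord2 (~~ o) x y) k k' -> uniq k ->
  flabel k' z = flabel k z + (if o then shift x y z else shift y x z).
Proof. by case: o => /= h un; rewrite (flabel_swap _ h). Qed.

Lemma subst1_permE s s' k k' : subst1 s s' k k' -> perm_eq s s' -> perm_eq k k'.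
Proof.
by move=> [u [v [-> ->]]] h; rewrite perm_cat2l perm_cat2r.
Qed.

Lemma perm_ord2 (T : eqType) o o' (x y : T) : perm_eq (ord2 o x y) (ord2 o' x y).
Proof. by case: o o' => [] [] //=; rewrite (perm_catC [:: _] [:: _]). Qed.

(** A triangle has three crossings [a], [b], [c] and three strands, carrying
    [{a, bar c}], [{b, bar a}], [{c, bar b}] in orders given by [oA], [oB], [oC].
    The last two equations hold when the three strands bound a triangular face, on
    either side. *)
Definition tri (oA oB oC : bool) (a b c : fletter) : bool :=
  [&& a.1 != b.1, b.1 != c.1, c.1 != a.1,
      a.2 (+) oC == b.2 (+) oA & b.2 (+) oA == c.2 (+) oB].

(** The flip of a triangle, one strand after the other. *)
Definition tri_flip (oA oB oC : bool) (a b c : fletter)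
    (k0 k1 k2 k3 : seq fletter) : Prop :=
  [/\ subst1 (ord2 oA a (bar c)) (ord2 (~~ oA) a (bar c)) k0 k1,
      subst1 (ord2 oB b (bar a)) (ord2 (~~ oB) b (bar a)) k1 k2 &
      subst1 (ord2 oC c (bar b)) (ord2 (~~ oC) c (bar b)) k2 k3].

Lemma tri_flip_perm oA oB oC a b c k0 k1 k2 k3 :
  tri_flip oA oB oC a b c k0 k1 k2 k3 ->
  [/\ perm_eq k0 k1, perm_eq k1 k2 & perm_eq k2 k3].
Proof.
by case=> h1 h2 h3; split;
  [apply: (subst1_permE h1)|apply: (subst1_permE h2)|apply: (subst1_permE h3)];
  exact: perm_ord2.
Qed.

(** The two labels at each crossing of the triangle change by the same amount. *)
Lemma chord_index_tri oA oB oC a b c k0 k1 k2 k3 n :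
  tri oA oB oC a b c -> tri_flip oA oB oC a b c k0 k1 k2 k3 ->
  uniq k0 -> chord_index k3 n = chord_index k0 n.
Proof.
move=> t ch un0; have [p1 p2 _] := tri_flip_perm ch; case: ch => h1 h2 h3.
have un1 : uniq k1 by rewrite -(perm_uniq p1).
have un2 : uniq k2 by rewrite -(perm_uniq p2).
rewrite /chord_index !(flabel_ord2 _ h3) // !(flabel_ord2 _ h2) // !(flabel_ord2 _ h1) //.
move: a b c t {h1 h2 h3} => [a sa] [b sb] [c sc].
rewrite /tri /= => /and5P[ab bc ca].
rewrite /shift !xpair_eqE; move: ab bc ca.
case: (n =P a) => [-> ab bc ca|_].
  rewrite (negPf ab) [a == c]eq_sym (negPf ca) /fstep.
  by case: oA oB oC sa sb sc => [] [] [] [] [] [] //=; lia.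
case: (n =P b) => [-> ab bc ca|_].
  rewrite (negPf bc) /fstep.
  by case: oA oB oC sa sb sc => [] [] [] [] [] [] //=; lia.
case: (n =P c) => [-> ab bc ca|_] //=.
  rewrite /fstep.
  by case: oA oB oC sa sb sc => [] [] [] [] [] [] //=; lia.
by case: oA oB oC => [] [] []; lia.
Qed.

Lemma fdwrithe_tri oA oB oC a b c k0 k1 k2 k3 n :
  tri oA oB oC a b c -> tri_flip oA oB oC a b c k0 k1 k2 k3 ->
  uniq k0 -> fdwrithe n k3 = fdwrithe n k0.
Proof.
move=> t ch un0; have [p1 p2 p3] := tri_flip_perm ch.
symmetry; apply: fdwrithe_perm; first exact: perm_trans (perm_trans p1 p2) p3.
by move=> x _; rewrite (chord_index_tri _ t ch).
Qed.

(** * Smoothing of flat words *)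

(** The cyclic word [k] read from just after [x] to just before [x]. *)
Definition after (k : seq fletter) (x : fletter) : seq fletter :=
  drop (index x k).+1 k ++ take (index x k) k.

(** The path from the passage [x] to the other passage through its crossing. *)
Definition strand (k : seq fletter) (x : fletter) : seq fletter :=
  take (index (bar x) (after k x)) (after k x).

(** Exchange of the sides at a crossing of which exactly one passage belongs to
    the reversed path [r]. *)
Definition freorient (r : seq fletter) (x : fletter) : fletter :=
  (x.1, x.2 (+) ((x \in r) (+) (bar x \in r))).

(** The smoothing against orientation at the crossing of [x], when [x] is the
    overpassage: the path from [x] to [bar x] is kept, the other is reversed. *)
Definition fsmooth (k : seq fletter) (x : fletter) : seq fletter :=
  map (freorient (strand k (bar x))) (strand k x ++ rev (strand k (bar x))).

Lemma index_mid (T : eqType) (u v : seq T) x :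
  x \notin u -> index x (u ++ x :: v) = size u.
Proof. by move=> xu; rewrite index_cat (negPf xu) /= eqxx addn0. Qed.

Lemma after_mid u v x : x \notin u -> after (u ++ x :: v) x = v ++ u.
Proof.
move=> xu; rewrite /after index_mid // take_size_cat //.
by rewrite -cat_rcons -(size_rcons u x) drop_size_cat.
Qed.

Lemma after_catl u v x : uniq (u ++ v) -> x \in u ->
  after (v ++ u) x = after (u ++ v) x.
Proof.
move=> un xu; move: un; case/splitPr: xu => a b un.
have [xa xbv] : x \notin a /\ x \notin b ++ v by apply: uniq_mid; rewrite -cat_cons catA.
rewrite -catA after_mid // catA after_mid ?catA // mem_cat negb_or xa andbT.
by move: xbv; rewrite mem_cat negb_or => /andP[].
Qed.

Lemma after_rot u v x : uniq (u ++ v) -> x \in u ++ v ->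
  after (v ++ u) x = after (u ++ v) x.
Proof.
move=> un; rewrite mem_cat => /orP[xu|xv]; first exact: after_catl.
by rewrite -after_catl // uniq_catC.
Qed.

Lemma strand_rot u v x : uniq (u ++ v) -> x \in u ++ v ->
  strand (v ++ u) x = strand (u ++ v) x.
Proof. by move=> un xin; rewrite /strand after_rot. Qed.

Lemma strand_head x q r : uniq (x :: q ++ bar x :: r) ->
  strand (x :: q ++ bar x :: r) x = q.
Proof.
move=> /= /andP[_ /uniq_mid[xq _]].
rewrite /strand -[x :: _]cat0s after_mid // cats0 index_mid //.
by rewrite take_size_cat.
Qed.

Lemma strands_eq u v x q r : uniq (u ++ v) -> v ++ u = x :: q ++ bar x :: r ->
  strand (u ++ v) x = q /\ strand (u ++ v) (bar x) = r.
Proof.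
move=> un e; have un' : uniq (v ++ u) by rewrite uniq_catC.
have e' : v ++ u = (x :: q) ++ (bar x :: r) by [].
have xin : x \in v ++ u by rewrite e' mem_head.
have bxin : bar x \in v ++ u by rewrite e' mem_cat mem_head orbT.
split; first by rewrite (strand_rot un') // e strand_head // -e.
rewrite (strand_rot un') // e' -strand_rot -?e' //.
have un2 : uniq ((bar x :: r) ++ x :: q) by rewrite uniq_catC -e'.
by have := @strand_head (bar x) r q; rewrite barK; apply.
Qed.

Lemma strandsP k x : flat_wf k -> x \in k ->
  exists u v, k = u ++ v /\ v ++ u = x :: strand k x ++ bar x :: strand k (bar x).
Proof.
move=> wf xk; have un := flat_wf_uniq wf; move: xk (xk) un wf.
case/splitPr=> u v xk un wf; exists u, (x :: v); split=> //.
have : bar x \in v ++ u.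
  by move: xk; rewrite -(mem_bar x wf) !mem_cat inE bar_neq orbC.
move=> h; have [q [r e]] : exists q r, v ++ u = q ++ bar x :: r.
  by case/splitPr: h => q r; exists q, r.
rewrite /= e; have /= [||-> -> //] := @strands_eq u (x :: v) x q r => //.
by rewrite e.
Qed.

Lemma strands_perm k x : flat_wf k -> x \in k ->
  perm_eq k ([:: x; bar x] ++ strand k x ++ strand k (bar x)).
Proof.
move=> wf xk; have [u [v [e e']]] := strandsP wf xk.
rewrite {1}e perm_catC e' /= perm_cons.
rewrite -cat_cons perm_sym -[bar x :: strand k x]/([:: bar x] ++ strand k x).
by rewrite -catA perm_catCA.
Qed.

Lemma freorient_bar r x : freorient r (bar x) = bar (freorient r x).
Proof. by case: x => c b; rewrite /freorient /bar /= negbK addNb [(_ \in r) (+) _]addbC. Qed.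

Lemma freorient_inj r : injective (freorient r).
Proof.
move=> x y e; have : x.1 == y.1 by case: e => ->.
rewrite eq_name => /orP[/eqP //|/eqP e']; move/eqP: e.
by rewrite e' freorient_bar bar_neq.
Qed.

Lemma flat_wf_map_freorient r k : flat_wf k -> flat_wf (map (freorient r) k).
Proof.
move=> wf; rewrite /flat_wf (map_inj_uniq (@freorient_inj r)) flat_wf_uniq //.
by apply/allP => _ /mapP[x xk ->]; rewrite -freorient_bar map_f // mem_bar.
Qed.

Lemma flat_wf_rem k k' x : perm_eq k ([:: x; bar x] ++ k') -> flat_wf k ->
  flat_wf k'.
Proof.
move=> p; rewrite (flat_wf_perm p) => wf.
have /= /and3P[] := flat_wf_uniq wf.
rewrite inE negb_or => /andP[_ xk] bxk un; rewrite /flat_wf un.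
apply/allP => y yk; have := mem_bar y wf; rewrite !inE yk !orbT.
case/or3P=> // /eqP e.
  have e' : y = bar x by rewrite -e barK.
  by rewrite -e' yk in bxk.
have e' : y = x by rewrite -[y]barK e barK.
by rewrite -e' yk in xk.
Qed.

Lemma flat_wf_strands k x : flat_wf k -> x \in k ->
  flat_wf (strand k x ++ strand k (bar x)).
Proof. by move=> wf xk; apply: flat_wf_rem (strands_perm wf xk) wf. Qed.

Lemma flat_wf_fsmooth k x : flat_wf k -> x \in k -> flat_wf (fsmooth k x).
Proof.
move=> wf xk; apply: flat_wf_map_freorient.
by rewrite (flat_wf_perm (k' := strand k x ++ strand k (bar x))) ?flat_wf_strands //
   perm_cat2l perm_rev.
Qed.

Lemma fsmooth_rot u v x : flat_wf (u ++ v) -> x \in u ++ v ->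
  fsmooth (v ++ u) x = fsmooth (u ++ v) x.
Proof. by move=> wf xin; rewrite /fsmooth !(@strand_rot u v) ?flat_wf_uniq ?mem_bar. Qed.

Lemma eq_freorient r r' x : (x \in r) = (x \in r') -> (bar x \in r) = (bar x \in r') ->
  freorient r x = freorient r' x.
Proof. by rewrite /freorient => -> ->. Qed.

(** Exchanging over and under at the smoothed crossing reverses the result. *)
Lemma fsmooth_bar k x : flat_wf k -> x \in k -> fsmooth k (bar x) = rev (fsmooth k x).
Proof.
move=> wf xk; rewrite /fsmooth barK -map_rev rev_cat revK.
have wf' := flat_wf_strands wf xk; have := flat_wf_uniq wf'.
rewrite cat_uniq => /and3P[_ /hasPn dis _].
have mem y : y \in strand k x ++ strand k (bar x) ->
    (y \in strand k x) = ~~ (y \in strand k (bar x)).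
  rewrite mem_cat => /orP[h|h]; last by rewrite h (negPf (dis _ h)).
  by rewrite h; symmetry; apply: contraL h => /dis.
apply/eq_in_map => y; rewrite mem_cat mem_rev orbC -mem_cat => yin.
rewrite /freorient (mem _ yin) mem ?(mem_bar y wf') //.
by congr (_, _ (+) _); do 2!case: (_ \in _).
Qed.

Lemma fdwrithe_fsmooth_bar n k x : flat_wf k -> x \in k ->
  fdwrithe n (fsmooth k (bar x)) = - fdwrithe n (fsmooth k x).
Proof. by move=> wf xk; rewrite fsmooth_bar // fdwrithe_rev // flat_wf_fsmooth. Qed.

Lemma subst1_rot s s' k k' x : subst1 s s' k k' -> x \in k -> x \notin s ->
  exists u v u' v' a b, [/\ k = u ++ v, k' = u' ++ v',
    v ++ u = x :: a ++ s ++ b & v' ++ u' = x :: a ++ s' ++ b].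
Proof.
move=> [u [v [-> ->]]]; rewrite !mem_cat => + /negPf xs; rewrite xs.
case/orP => /splitPr[a b].
  exists a, (x :: b ++ s ++ v), a, (x :: b ++ s' ++ v), b, (v ++ a).
  by split; rewrite /= -!catA.
exists (u ++ s ++ a), (x :: b), (u ++ s' ++ a), (x :: b), (b ++ u), a.
by split; rewrite /= -!catA.
Qed.

(** [s], reversed if [r]. *)
Definition rv (r : bool) (s : seq fletter) := if r then rev s else s.

(** A replacement that does not touch the smoothed crossing remains a replacement
    of a factor of the smoothed word; the factor is reversed when it lies on the
    reversed path, as told by [r].  Here [f] stands for the exchange of sides. *)
Lemma subst1_fsmooth f s s' k k' x :
  subst1 s s' k k' -> uniq k -> uniq k' -> x \in k -> bar x \in k ->
  x \notin s -> bar x \notin s ->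
  exists r, [/\ subst1 (rv r (map f s)) (rv r (map f s'))
       (map f (strand k x ++ rev (strand k (bar x))))
       (map f (strand k' x ++ rev (strand k' (bar x)))),
    {in s, forall y, (y \in strand k (bar x)) = r},
    {in s', forall y, (y \in strand k' (bar x)) = r} &
    forall y, y \notin s -> y \notin s' ->
      (y \in strand k (bar x)) = (y \in strand k' (bar x))].
Proof.
move=> h un un' xk bxk xs bxs.
have [u [v [u' [v' [a [b [e e' r r']]]]]]] := subst1_rot h xk xs.
have : bar x \in a ++ b.
  move: bxk; rewrite e mem_cat orbC -mem_cat r inE bar_neq !mem_cat.
  by rewrite (negPf bxs).
have unr : uniq (v ++ u) by rewrite uniq_catC -e.
have unr' : uniq (v' ++ u') by rewrite uniq_catC -e'.
rewrite mem_cat => /orP[] bxin; move: r r'.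
- case/splitPr: bxin => c d r r'.
  have [||] := @strands_eq u v x c (d ++ s ++ b); rewrite -?e //.
    by rewrite r -!catA.
  have [||] := @strands_eq u' v' x c (d ++ s' ++ b); rewrite -?e' //.
    by rewrite r' -!catA.
  move=> -> -> -> ->; exists true; split.
  + exists (map f (c ++ rev b)), (map f (rev d)).
    by rewrite /rv -!map_rev -!map_cat !rev_cat !catA.
  + by move=> y ys; rewrite !mem_cat ys orbT.
  + by move=> y ys; rewrite !mem_cat ys orbT.
  + by move=> y /negPf ys /negPf ys'; rewrite !mem_cat ys ys'.
- case/splitPr: bxin => c d r r'.
  have [||] := @strands_eq u v x (a ++ s ++ c) d; rewrite -?e //.
    by rewrite r -!catA.
  have [||] := @strands_eq u' v' x (a ++ s' ++ c) d; rewrite -?e' //.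
    by rewrite r' -!catA.
  move=> -> -> -> ->; exists false; split=> //.
  + exists (map f a), (map f (c ++ rev d)).
    by rewrite /rv -!map_cat -!catA.
  + move=> y ys; apply/negP => yd.
    have : uniq ((a ++ s ++ c) ++ bar x :: d).
      by move: unr; rewrite r -!catA => /= /andP[].
    rewrite cat_uniq => /and3P[_ /hasPn /(_ y)].
    by rewrite !mem_cat inE ys yd !orbT => /(_ isT).
  + move=> y ys; apply/negP => yd.
    have : uniq ((a ++ s' ++ c) ++ bar x :: d).
      by move: unr'; rewrite r' -!catA => /= /andP[].
    rewrite cat_uniq => /and3P[_ /hasPn /(_ y)].
    by rewrite !mem_cat inE ys yd !orbT => /(_ isT).
Qed.

(** * Smoothing away from a move *)

(** Passages of [r] through other crossings than that of [x] do not matter. *)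
Lemma freorient_skip s r r' x : r =i s ++ r' -> all (fun y => y.1 != x.1) s ->
  freorient r x = freorient r' x.
Proof.
move=> e /allP h; have ns y : y.1 = x.1 -> y \in s = false.
  by move=> ey; apply/negP => /h; rewrite ey eqxx.
by apply: eq_freorient; rewrite e mem_cat ns.
Qed.

Lemma freorient_id r x : flat_wf r -> freorient r x = x.
Proof. by move=> wf; rewrite /freorient mem_bar // addbb addbF -surjective_pairing. Qed.

Lemma freorient_notin r x : all (fun y => y.1 != x.1) r -> freorient r x = x.
Proof.
move=> h; rewrite (@freorient_skip r r [::]) ?freorient_id //.
by rewrite cats0.
Qed.

Lemma fresh_names k s r x : perm_eq k (s ++ r) -> uniq k ->
  x \in s -> bar x \in s -> all (fun y => y.1 != x.1) r.
Proof.
move=> p; rewrite (perm_uniq p) cat_uniq => /and3P[_ /hasPn dis _] xs bxs.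
apply/allP => y yr; rewrite eq_name negb_or.
by apply/andP; split; apply: contraNneq (dis _ yr) => ->.
Qed.

Lemma fdwrithe_fsmooth_monogon n y k k' x : subst1 [::] [:: y; bar y] k k' ->
  flat_wf k -> flat_wf k' -> x \in k -> fdwrithe n (fsmooth k' x) = fdwrithe n (fsmooth k x).
Proof.
move=> h wf wf' xk; have bxk : bar x \in k by rewrite mem_bar.
have xk' : x \in k'.
  rewrite (perm_mem (subst1_perm (t := [:: y; bar y]) h _)) ?cats0 //.
  by rewrite mem_cat xk orbT.
set f := freorient (strand k' (bar x)).
have [||||||r [hK _ hy hz]] := subst1_fsmooth f h (x := x); rewrite ?flat_wf_uniq //.
have -> : fsmooth k x = map f (strand k x ++ rev (strand k (bar x))).
  apply/eq_in_map => z zin; have zk : z \in k.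
    rewrite (perm_mem (strands_perm wf xk)) mem_cat orbC.
    by move: zin; rewrite !mem_cat mem_rev => ->.
  have pm : perm_eq k' ([:: y; bar y] ++ k).
    by apply: (subst1_perm h); rewrite cats0.
  have := flat_wf_uniq wf'; rewrite (perm_uniq pm) cat_uniq => /and3P[_ /hasPn dis _].
  apply: eq_freorient; apply: hz => //; apply: dis => //.
  by rewrite mem_bar.
have wfK := flat_wf_fsmooth wf' xk'; rewrite -/f in hK.
case: r {hy} hK => hK.
  apply: (@fdwrithe_monogon n (bar (f y))); last exact: flat_wf_uniq.
  by move: hK; rewrite /= /f !freorient_bar barK.
apply: (@fdwrithe_monogon n (f y)); last exact: flat_wf_uniq.
by move: hK; rewrite /= /f !freorient_bar.
Qed.

Lemma map_ord2 (T U : Type) (f : T -> U) o x y :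
  map f (ord2 o x y) = ord2 o (f x) (f y).
Proof. by case: o. Qed.

Lemma rv_ord2 r o x y : rv r (ord2 o x y) = ord2 (o (+) r) x y.
Proof. by case: r o => [] []. Qed.

Lemma mem_ord2 (T : eqType) o (x y z : T) :
  (z \in ord2 o x y) = (z == x) || (z == y).
Proof. by case: o; rewrite !inE // orbC. Qed.

Lemma fdwrithe_fsmooth_bigon n p1 p2 o k0 k1 k2 x :
  subst1 [::] [:: p1; p2] k0 k1 ->
  subst1 [::] (ord2 o (bar p1) (bar p2)) k1 k2 ->
  p1.2 != p2.2 -> flat_wf k0 -> flat_wf k2 -> x \in k0 ->
  fdwrithe n (fsmooth k2 x) = fdwrithe n (fsmooth k0 x).
Proof.
move=> h1 h2 ne wf0 wf2 xk; have [pm1 pm] := bigon_perm h1 h2.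
have bxk : bar x \in k0 by rewrite mem_bar.
have un2 := flat_wf_uniq wf2.
have un1 := bigon_uniq h1 h2 un2.
have [xk1 bxk1] : x \in k1 /\ bar x \in k1.
  by rewrite !(perm_mem pm1) !mem_cat xk bxk !orbT.
have xk2 : x \in k2 by rewrite (perm_mem pm) mem_cat xk orbT.
set f := freorient (strand k2 (bar x)).
have := un2; rewrite (perm_uniq pm) cat_uniq => /and3P[un4 /hasPn dis _].
have [||||||r1 [hK1 _ hy1 hz1]] := subst1_fsmooth f h1 (x := x); rewrite ?(flat_wf_uniq wf0) //.
have nin w : w \in k0 -> w \notin ord2 o (bar p1) (bar p2).
  by move=> /dis; rewrite mem_ord2 !inE !negb_or => /and4P[_ _ -> ->].
have [//|//|//|//|||r2 [hK2 _ hy2 hz2]] := subst1_fsmooth f h2 (x := x); rewrite ?nin //.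
have -> : fsmooth k0 x = map f (strand k0 x ++ rev (strand k0 (bar x))).
  apply/eq_in_map => z zin; have zk : z \in k0.
    rewrite (perm_mem (strands_perm wf0 xk)) mem_cat orbC.
    by move: zin; rewrite !mem_cat mem_rev => ->.
  have aux w : w \in k0 -> (w \in strand k0 (bar x)) = (w \in strand k2 (bar x)).
    move=> /dis; rewrite !inE !negb_or => /and4P[w1 w2 w3 w4].
    by rewrite hz1 ?hz2 // ?mem_ord2 ?inE negb_or ?w1 ?w3 // ?w2.
  by apply: eq_freorient; apply: aux => //; rewrite mem_bar.
have wfK := flat_wf_fsmooth wf2 xk2.
have [m1 m2] : (p1 \in strand k2 (bar x)) = r1 /\ (p2 \in strand k2 (bar x)) = r1.
  move: un4; rewrite /= !inE !negb_or => /and4P[/and3P[n1 n2 n3] /andP[n4 n5] _ _].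
  by rewrite -!hz2 ?hy1 ?inE ?eqxx ?orbT // mem_ord2 negb_or ?n2 ?n4.
have [m3 m4] : (bar p1 \in strand k2 (bar x)) = r2 /\ (bar p2 \in strand k2 (bar x)) = r2.
  by rewrite !hy2 ?mem_ord2 ?eqxx ?orbT.
have ne' : (f p1).2 != (f p2).2.
  rewrite /f /freorient /= m1 m2 m3 m4; move: ne.
  by case: (p1.2) (p2.2) (r1 (+) r2) => [] [] [].
move: hK1 hK2; rewrite -/f !map_ord2 rv_ord2 /f !freorient_bar -/f.
have -> : rv r1 (map f [::]) = [::] by case: (r1).
have -> : rv r2 (map f [::]) = [::] by case: (r2).
case: (r1) => hK1 hK2.
  apply: (@fdwrithe_bigon n _ _ (~~ (o (+) r2)) _ _ _ hK1) => //; last exact: flat_wf_uniq.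
    by case: (o (+) r2) hK2.
  by rewrite eq_sym.
by apply: (@fdwrithe_bigon n (f p1) (f p2) (o (+) r2) _ _ _ hK1 hK2) => //; exact: flat_wf_uniq.
Qed.

(** Reversing some of the three strands gives again a triangle, for the orders
    [oA (+) r1], [oB (+) r2], [oC (+) r3]. *)
Lemma fdwrithe_fsmooth_tri n oA oB oC a b c k0 k1 k2 k3 x :
  tri oA oB oC a b c -> tri_flip oA oB oC a b c k0 k1 k2 k3 ->
  flat_wf k0 -> x \in k0 ->
  x.1 != a.1 -> x.1 != b.1 -> x.1 != c.1 ->
  fdwrithe n (fsmooth k3 x) = fdwrithe n (fsmooth k0 x).
Proof.
move=> t ch wf xk xa xb xc.
have [p1 p2 p3] := tri_flip_perm ch; case: ch => h1 h2 h3.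
have wf1 : flat_wf k1 by rewrite -(flat_wf_perm p1).
have wf2 : flat_wf k2 by rewrite -(flat_wf_perm p2).
have wf3 : flat_wf k3 by rewrite -(flat_wf_perm p3).
have xk1 : x \in k1 by rewrite -(perm_mem p1).
have xk2 : x \in k2 by rewrite -(perm_mem p2).
have nin o u v : x.1 != u.1 -> x.1 != v.1 -> x \notin ord2 o u v /\ bar x \notin ord2 o u v.
  move=> xu xv; rewrite !mem_ord2 !negb_or; split; apply/andP; split;
  by [apply: contraNneq xu => <-|apply: contraNneq xv => <-].
set f := freorient (strand k0 (bar x)).
have [||||||r1 [hK1 hs1 hs1' hz1]] := subst1_fsmooth f h1 (x := x);
  rewrite ?(flat_wf_uniq wf) ?(flat_wf_uniq wf1) ?(mem_bar _ wf) //;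
  try by case: (nin oA a (bar c)).
have [||||||r2 [hK2 hs2 hs2' hz2]] := subst1_fsmooth f h2 (x := x);
  rewrite ?(flat_wf_uniq wf1) ?(flat_wf_uniq wf2) ?(mem_bar _ wf1) //;
  try by case: (nin oB b (bar a)).
have [||||||r3 [hK3 hs3 hs3' hz3]] := subst1_fsmooth f h3 (x := x);
  rewrite ?(flat_wf_uniq wf2) ?(flat_wf_uniq wf3) ?(mem_bar _ wf2) //;
  try by case: (nin oC c (bar b)).
have e1 : strand k0 (bar x) =i strand k1 (bar x).
  move=> y; have [ys|ys] := boolP (y \in ord2 oA a (bar c)); last first.
    by apply: hz1 => //; rewrite mem_ord2 -(mem_ord2 oA).
  by rewrite hs1 // hs1' // mem_ord2 -(mem_ord2 oA).
have e2 : strand k1 (bar x) =i strand k2 (bar x).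
  move=> y; have [ys|ys] := boolP (y \in ord2 oB b (bar a)); last first.
    by apply: hz2 => //; rewrite mem_ord2 -(mem_ord2 oB).
  by rewrite hs2 // hs2' // mem_ord2 -(mem_ord2 oB).
have e3 : strand k2 (bar x) =i strand k3 (bar x).
  move=> y; have [ys|ys] := boolP (y \in ord2 oC c (bar b)); last first.
    by apply: hz3 => //; rewrite mem_ord2 -(mem_ord2 oC).
  by rewrite hs3 // hs3' // mem_ord2 -(mem_ord2 oC).
have -> : fsmooth k3 x = map f (strand k3 x ++ rev (strand k3 (bar x))).
  by apply/eq_map => z; apply: eq_freorient; rewrite e1 e2 e3.
have [ma mc'] : (a \in strand k0 (bar x)) = r1 /\ (bar c \in strand k0 (bar x)) = r1.
  by rewrite !hs1 ?mem_ord2 ?eqxx ?orbT.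
have [mb ma'] : (b \in strand k0 (bar x)) = r2 /\ (bar a \in strand k0 (bar x)) = r2.
  by rewrite !e1 !hs2 ?mem_ord2 ?eqxx ?orbT.
have [mc mb'] : (c \in strand k0 (bar x)) = r3 /\ (bar b \in strand k0 (bar x)) = r3.
  by rewrite !e1 !e2 !hs3 ?mem_ord2 ?eqxx ?orbT.
move: hK1 hK2 hK3; rewrite !map_ord2 !rv_ord2 !addNb /f !freorient_bar -/f => hK1 hK2 hK3.
apply: (@fdwrithe_tri (oA (+) r1) (oB (+) r2) (oC (+) r3) (f a) (f b) (f c)).
- move: t; rewrite /tri /f /freorient /= ma ma' mb mb' mc mc'.
  case/and5P=> -> -> -> /=; case: (a.2) (b.2) (c.2) => [] [] [];
  by case: (oA) (oB) (oC) (r1) (r2) (r3) => [] [] [] [] [] [].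
- by split; [exact: hK1|exact: hK2|exact: hK3].
- by rewrite flat_wf_uniq // (flat_wf_fsmooth wf xk).
Qed.

(** * Smoothing at a crossing of a monogon or of a bigon *)

(** One of the two paths at the crossing of a monogon is empty; here it is the
    kept one, and the smoothing is the rest of the word reversed. *)
Lemma fdwrithe_fsmooth_monogon_self n y u v : flat_wf (u ++ [:: y; bar y] ++ v) ->
  fdwrithe n (fsmooth (u ++ [:: y; bar y] ++ v) y) = - fdwrithe n (u ++ [:: y; bar y] ++ v).
Proof.
move=> wf; have un := flat_wf_uniq wf.
rewrite /fsmooth.
have [||-> ->] := @strands_eq u ([:: y; bar y] ++ v) y [::] (v ++ u) => //.
have p : perm_eq (u ++ [:: y; bar y] ++ v) ([:: y; bar y] ++ (v ++ u)).
  by rewrite perm_catC -catA.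
have wf' : flat_wf (v ++ u) := flat_wf_rem p wf.
rewrite /= (eq_map (fun z => freorient_id z wf')) map_id fdwrithe_rev //.
rewrite (@fdwrithe_rot n u v) -?(flat_wf_perm (permEl (perm_catC v u))) //.
by rewrite (@fdwrithe_monogon n y (u ++ v) (u ++ [:: y; bar y] ++ v)) //; exists u, v.
Qed.

Lemma flat_wf_rot u v : flat_wf (u ++ v) = flat_wf (v ++ u).
Proof. by apply: flat_wf_perm; rewrite perm_catC. Qed.

Lemma strands_head x q r : uniq (x :: q ++ bar x :: r) ->
  strand (x :: q ++ bar x :: r) x = q /\ strand (x :: q ++ bar x :: r) (bar x) = r.
Proof.
move=> un; have [||] := @strands_eq [::] (x :: q ++ bar x :: r) x q r.
- by [].
- by rewrite cats0.
- by [].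
Qed.

Lemma fsmooth_head x q r : uniq (x :: q ++ bar x :: r) ->
  fsmooth (x :: q ++ bar x :: r) x = map (freorient r) (q ++ rev r).
Proof. by move=> un; rewrite /fsmooth; have [-> ->] := strands_head un. Qed.

(** The strands of the bigon are parallel if [o], antiparallel otherwise. *)
Lemma fdwrithe_fsmooth_bigon_self n o p1 p2 v w :
  let k := [:: p1; p2] ++ v ++ ord2 o (bar p1) (bar p2) ++ w in
  flat_wf k -> p1.2 != p2.2 -> fdwrithe n (fsmooth k p1) = fdwrithe n (fsmooth k p2).
Proof.
move=> k wf ne; have un := flat_wf_uniq wf.
have pm : perm_eq k ([:: p1; p2; bar p1; bar p2] ++ (v ++ w)).
  rewrite -[_ ++ v ++ w]/([:: p1; p2] ++ [:: bar p1; bar p2] ++ (v ++ w)).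
  rewrite /k perm_cat2l perm_catCA perm_cat2r.
  exact: (@perm_ord2 _ o true).
have un2 := un; rewrite (perm_uniq pm) in un2.
have f1 : all (fun y => y.1 != p1.1) (v ++ w).
  by apply: (fresh_names pm) => //; rewrite !inE eqxx ?orbT.
have f2 : all (fun y => y.1 != p2.1) (v ++ w).
  by apply: (fresh_names pm) => //; rewrite !inE eqxx ?orbT.
have p1k : p1 \in k by rewrite mem_head.
have p2k : p2 \in k by rewrite !inE eqxx orbT.
have n12 : p1.1 != p2.1.
  rewrite eq_name; apply/negP => /orP[/eqP e|/eqP e]; move: un2;
  by rewrite /= !inE e ?barK ?eqxx ?orbT ?andbF.
have wfs1 := flat_wf_fsmooth wf p1k; have wfs2 := flat_wf_fsmooth wf p2k.
case: o @k wf un pm p1k p2k wfs1 wfs2 => k wf un pm p1k p2k wfs1 wfs2.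
(* Parallel strands: in each smoothing the other crossing is a monogon, whose
   removal leaves [v ++ rev w]. *)
- have e1 : k = p1 :: (p2 :: v) ++ bar p1 :: (bar p2 :: w) by [].
  have e2 : fsmooth k p2 = fsmooth (p2 :: (v ++ [:: bar p1]) ++ bar p2 :: (w ++ [:: p1])) p2.
    have := @fsmooth_rot [:: p1] (p2 :: v ++ [:: bar p1, bar p2 & w]) p2 wf p2k.
    by move=> <-; rewrite /= -!catA.
  have un' : uniq (p2 :: (v ++ [:: bar p1]) ++ bar p2 :: (w ++ [:: p1])).
    move: un; rewrite -[k]/([:: p1] ++ (p2 :: v ++ [:: bar p1, bar p2 & w])) uniq_catC.
    by rewrite /= -!catA.
  rewrite e2 fsmooth_head // in wfs2 *.
  rewrite e1 fsmooth_head -?e1 // in wfs1 *.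
  set f := freorient _ in wfs1 *; set f' := freorient _ in wfs2 *.
  have -> : fdwrithe n (map f ((p2 :: v) ++ rev (bar p2 :: w))) =
            fdwrithe n (map f (v ++ rev w)).
    rewrite rev_cons -cats1 -[p2 :: v]cat1s -catA map_cat in wfs1 *.
    rewrite -fdwrithe_rot // !map_cat -!catA.
    apply: (@fdwrithe_monogon n (bar (f p2))); last first.
      by move/flat_wf_uniq: wfs1; rewrite uniq_catC !map_cat -!catA.
    exists (map f (v ++ rev w)), [::]; rewrite barK /f -freorient_bar -/f !map_cat.
    by rewrite !cats0 -!catA.
  have -> : fdwrithe n (map f' ((v ++ [:: bar p1]) ++ rev (w ++ [:: p1]))) =
            fdwrithe n (map f' (v ++ rev w)).
    apply: (@fdwrithe_monogon n (f' (bar p1))); last exact: flat_wf_uniq.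
    exists (map f' v), (map f' (rev w)); rewrite -map_cat; split=> //.
    by rewrite rev_cat -!catA !map_cat /f' -!freorient_bar barK.
  congr fdwrithe; apply/eq_in_map => z zin.
  have zvw : z \in v ++ w by move: zin; rewrite !mem_cat mem_rev.
  rewrite /f /f' (@freorient_skip [:: bar p2] _ w) //=; last first.
    by move/allP: f2 => /(_ z zvw); rewrite eq_sym => ->.
  rewrite (@freorient_skip [:: p1] (w ++ _) w) //=.
    by move=> y; rewrite mem_cat orbC -mem_cat.
  by move/allP: f1 => /(_ z zvw); rewrite eq_sym => ->.
(* Antiparallel strands: in each smoothing the other crossing separates [v] from
   [rev w], and its passages are on the same sides. *)
- have e1 : k = p1 :: (p2 :: v ++ [:: bar p2]) ++ bar p1 :: w by rewrite /k /= -catA.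
  have e2 : fsmooth k p2 = fsmooth (p2 :: v ++ bar p2 :: (bar p1 :: w ++ [:: p1])) p2.
    have := @fsmooth_rot [:: p1] (p2 :: v ++ [:: bar p2, bar p1 & w]) p2 wf p2k.
    by move=> <-; rewrite /= -!catA.
  have un' : uniq (p2 :: v ++ bar p2 :: (bar p1 :: w ++ [:: p1])).
    move: un; rewrite -[k]/([:: p1] ++ (p2 :: v ++ [:: bar p2, bar p1 & w])) uniq_catC.
    by rewrite /= -!catA.
  rewrite e2 fsmooth_head // in wfs2 *.
  rewrite e1 fsmooth_head -?e1 // in wfs1 *.
  set f := freorient _ in wfs1 *; set f' := freorient _ in wfs2 *.
  have fp2 : f p2 = p2.
    by apply: freorient_notin; move: f2; rewrite all_cat => /andP[].
  have f'p1 : f' p1 = p1.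
    by rewrite /f' /freorient !inE !mem_cat !inE eqxx ?eqxx !orbT addbF -surjective_pairing.
  have ff : {in v ++ w, f =1 f'}.
    move=> z zvw; rewrite /f /f' (@freorient_skip [:: p1; bar p1] (_ :: _) w) //=.
      move=> y; rewrite !(inE, mem_cat).
      by case: (y == p1) (y == bar p1) (y \in w) => [] [] [].
    by move/allP: f1 => /(_ z zvw); rewrite eq_sym => ->.
  have -> : map f ((p2 :: v ++ [:: bar p2]) ++ rev w) =
      p2 :: map f v ++ bar p2 :: map f (rev w).
    by rewrite /= -catA !map_cat /= /f freorient_bar -/f fp2.
  have e' : map f' (v ++ rev (bar p1 :: w ++ [:: p1])) =
      (map f v ++ p1 :: map f (rev w)) ++ [:: bar p1].
    rewrite rev_cons rev_cat -cats1 !map_cat /= f'p1 /f' freorient_bar -/f' f'p1 -catA.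
    congr (_ ++ _ :: (_ ++ _)); apply/eq_in_map => z zin; rewrite ff //.
      by rewrite mem_cat zin.
    by rewrite mem_cat -[z \in w]mem_rev zin orbT.
  rewrite {}e' in wfs2 *.
  rewrite -fdwrithe_rot //=.
  (* exchange of the names of the two crossings *)
  pose s c := if c == p1.1 then p2.1 else if c == p2.1 then p1.1 else c.
  have s_inj : injective s.
    apply: inv_inj => c; rewrite /s.
    case: (c =P p1.1) => [->|/eqP c1]; first by rewrite eq_sym (negPf n12) eqxx.
    case: (c =P p2.1) => [->|/eqP c2]; first by rewrite eqxx.
    by rewrite (negPf c1) (negPf c2).
  have b12 : p2.2 = ~~ p1.2 by move: ne; case: (p1.2) (p2.2) => [] [].
  have rid t : {subset t <= v ++ w} -> map (ren s) (map f t) = map f t.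
    move=> sub; rewrite -map_comp; apply/eq_in_map => z /sub zin.
    rewrite /= /ren /s /=; move/allP: f1 => /(_ z zin) /negPf ->.
    by move/allP: f2 => /(_ z zin) /negPf ->.
  rewrite -(fdwrithe_ren n _ s_inj) /= map_cat /= !rid; first last.
  + by move=> z zv; rewrite mem_cat zv.
  + by move=> z zw; rewrite mem_cat -[z \in w]mem_rev zw orbT.
  congr (fdwrithe _ (_ :: _ ++ _ :: _)).
    by rewrite /ren /s /bar eq_sym (negPf n12) eqxx b12.
  by rewrite /ren /s /bar /= eq_sym (negPf n12) eqxx b12 negbK -surjective_pairing.
Qed.

(** * Smoothing at a crossing of a triangle *)

Lemma rev_ord2 (T : Type) o (x y : T) : rev (ord2 o x y) = ord2 (~~ o) x y.
Proof. by case: o. Qed.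

Lemma ord2_sym (T : Type) o (x y : T) : ord2 o x y = ord2 (~~ o) y x.
Proof. by case: o. Qed.

Lemma name_neq (x y : fletter) : x.1 != y.1 ->
  [/\ (x == y) = false, (x == bar y) = false,
      (bar x == y) = false & (bar x == bar y) = false].
Proof. by case: x y => [c b] [d e] /= /negPf h; rewrite /bar !xpair_eqE /= h. Qed.

Lemma notin_names r (x : fletter) : all (fun y => y.1 != x.1) r ->
  (x \in r) = false /\ (bar x \in r) = false.
Proof. by move/allP => h; split; apply/negP => /h; rewrite eqxx. Qed.

Lemma freorient_fix r x : (x \in r) = (bar x \in r) -> freorient r x = x.
Proof. by rewrite /freorient => ->; rewrite addbb addbF -surjective_pairing. Qed.

Lemma freorient_flip r x : (x \in r) = ~~ (bar x \in r) -> freorient r x = bar x.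
Proof. by rewrite /freorient => ->; rewrite addNb addbb addbT. Qed.

(** A word with a triangle whose first strand is at the start. *)
Definition tri_word oA oB oC a b c (u v w : seq fletter) : seq fletter :=
  ord2 oA a (bar c) ++ u ++ ord2 oB b (bar a) ++ v ++ ord2 oC c (bar b) ++ w.

Lemma tri_word_perm oA oB oC a b c u v w :
  perm_eq (tri_word oA oB oC a b c u v w)
    ([:: a; b; c; bar a; bar b; bar c] ++ (u ++ v ++ w)).
Proof.
rewrite /tri_word.
have p : perm_eq ([:: a; b; c; bar a; bar b; bar c] ++ (u ++ v ++ w))
   (ord2 oA a (bar c) ++ ord2 oB b (bar a) ++ ord2 oC c (bar b) ++ u ++ v ++ w).
  rewrite !catA 3!perm_cat2r -!catA.
  apply/permP => q; rewrite !count_cat; case: oA oB oC => [] [] [] /=; lia.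
rewrite perm_sym (perm_trans p) // perm_sym perm_cat2l.
apply/permP => q; rewrite !count_cat; lia.
Qed.

Lemma flat_wf_tri_word oA oB oC oA' oB' oC' a b c u v w :
  flat_wf (tri_word oA oB oC a b c u v w) = flat_wf (tri_word oA' oB' oC' a b c u v w).
Proof.
by rewrite (flat_wf_perm (tri_word_perm oA oB oC a b c u v w))
           (flat_wf_perm (tri_word_perm oA' oB' oC' a b c u v w)).
Qed.

Lemma tri_word_names oA oB oC a b c u v w :
  uniq (tri_word oA oB oC a b c u v w) ->
  [/\ all (fun y => y.1 != a.1) (u ++ v ++ w),
      all (fun y => y.1 != b.1) (u ++ v ++ w) &
      all (fun y => y.1 != c.1) (u ++ v ++ w)].
Proof.
move=> un; have pm := tri_word_perm oA oB oC a b c u v w.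
by split; apply: (fresh_names pm) => //; rewrite !inE eqxx ?orbT.
Qed.

(** The case where both strands through [a] meet it first: in both smoothings the
    other two crossings form a bigon. *)
Lemma fdwrithe_fsmooth_tri_parallel n oC a b c u v w :
  tri true false oC a b c -> flat_wf (tri_word true false oC a b c u v w) ->
  fdwrithe n (fsmooth (tri_word false true (~~ oC) a b c u v w) a) =
  fdwrithe n (fsmooth (tri_word true false oC a b c u v w) a).
Proof.
case/and5P=> ab bc ca t1 t2; set k := tri_word _ _ _ _ _ _ _ _ _.
set k' := tri_word _ _ _ _ _ _ _ _ _ => wf.
have wf' : flat_wf k'.
  by move: wf; rewrite /k /k' (flat_wf_tri_word _ _ _ false true (~~ oC)).
have un := flat_wf_uniq wf; have un' := flat_wf_uniq wf'.
have ak : a \in k by rewrite mem_head.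
have ak' : a \in k' by rewrite !inE eqxx orbT.
have [fa fb fc] := tri_word_names un.
have := fb; rewrite !all_cat.
case/and3P=> /notin_names[bu bu'] /notin_names[bv bv'] /notin_names[bw bw'].
have := fc; rewrite !all_cat.
case/and3P=> /notin_names[cu cu'] /notin_names[cv cv'] /notin_names[cw cw'].
have [bc1 bc2 bc3 bc4] := name_neq bc.
have [cb1 cb2 cb3 cb4] : [/\ (c == b) = false, (c == bar b) = false,
      (bar c == b) = false & (bar c == bar b) = false].
  by apply: name_neq; rewrite eq_sym.
have memE := (in_cons, in_nil, mem_cat, mem_ord2, orbT, orbF,
  (bu, bu', bv, bv', bw, bw'), (cu, cu', cv, cv', cw, cw'),
  (bc1, bc2, bc3, bc4), (cb1, cb2, cb3, cb4), (eqxx, bar_neq, neq_bar)).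
have wfs := flat_wf_fsmooth wf ak; have wfs' := flat_wf_fsmooth wf' ak'.
have e1 : k = a :: (bar c :: u) ++ bar a :: (b :: v ++ ord2 oC c (bar b) ++ w) by [].
have e2 : fsmooth k' a =
    fsmooth (a :: (u ++ [:: b]) ++ bar a :: (v ++ ord2 (~~ oC) c (bar b) ++ w ++ [:: bar c])) a.
  have := @fsmooth_rot [:: bar c]
    (a :: u ++ [:: b, bar a & v ++ ord2 (~~ oC) c (bar b) ++ w]) a wf' ak'.
  by move=> <-; rewrite /= -!catA /= -!catA.
have un2 : uniq (a :: (u ++ [:: b]) ++
    bar a :: (v ++ ord2 (~~ oC) c (bar b) ++ w ++ [:: bar c])).
  move: un'; rewrite -[k']/([:: bar c] ++
    (a :: u ++ [:: b, bar a & v ++ ord2 (~~ oC) c (bar b) ++ w])).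
  by rewrite uniq_catC /= -!catA /= -!catA.
rewrite e2 fsmooth_head // in wfs' *.
rewrite e1 fsmooth_head -?e1 // in wfs *.
set f := freorient (b :: v ++ ord2 oC c (bar b) ++ w) in wfs *.
set f' := freorient (v ++ ord2 (~~ oC) c (bar b) ++ w ++ [:: bar c]) in wfs' *.
have fb1 : f b = b by apply: freorient_fix; rewrite !memE.
have fc1 : f (bar c) = c by rewrite /f freorient_flip ?barK // !memE.
have fb2 : f' b = bar b by apply: freorient_flip; rewrite !memE.
have fc2 : f' (bar c) = bar c by apply: freorient_fix; rewrite barK !memE.
have fc3 : f c = bar c by rewrite -{1}[c]barK /f freorient_bar -/f fc1.
have fc4 : f' c = c by rewrite -{1}[c]barK /f' freorient_bar -/f' fc2 barK.
have ff : {in u ++ v ++ w, f =1 f'}.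
  move=> z zin; rewrite /f /f'.
  rewrite (@freorient_skip (b :: ord2 oC c (bar b)) (_ :: _) (v ++ w)); last first.
  - move/allP: fb => /(_ z zin) zb; move/allP: fc => /(_ z zin) zc.
    by case: (oC); rewrite /= eq_sym zb eq_sym zc ?[c.1 == _]eq_sym ?[b.1 == _]eq_sym ?zb ?zc.
  - move=> y; rewrite !(inE, mem_cat, mem_ord2).
    by case: (y == b) (y == c) (y == bar b) (y \in v) => [] [] [] [].
  rewrite (@freorient_skip (bar c :: ord2 (~~ oC) c (bar b)) (v ++ _) (v ++ w)) //.
  - move=> y; rewrite !(inE, mem_cat, mem_ord2).
    by case: (y == bar c) (y == c) (y == bar b) (y \in v) (y \in w) => [] [] [] [] [].
  - move/allP: fb => /(_ z zin) zb; move/allP: fc => /(_ z zin) zc.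
    by case: (oC); rewrite /= eq_sym zc /= ?[c.1 == _]eq_sym ?[b.1 == _]eq_sym ?zb ?zc.
(* [b] and [c] are on opposite sides, as required for a bigon. *)
have b2 : b.2 != c.2.
  by move: t1 t2; case: (a.2) (b.2) (c.2) (oC) => [] [] [] [].
have -> : fdwrithe n (map f ((bar c :: u) ++ rev (b :: v ++ ord2 oC c (bar b) ++ w))) =
   fdwrithe n (map f (u ++ rev w ++ rev v)).
  rewrite rev_cons !rev_cat rev_ord2 -cats1 /= !map_cat /= map_ord2.
  rewrite fc1 fb1 fc3 /f freorient_bar -/f fb1.
  rewrite rev_cons !rev_cat rev_ord2 -cats1 /= !map_cat /= map_ord2 in wfs.
  rewrite fc1 fb1 fc3 /f freorient_bar -/f fb1 in wfs.
  rewrite ord2_sym negbK in wfs *.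
  have := @fdwrithe_rot n (c :: map f u ++
    (map f (rev w) ++ ord2 oC (bar b) (bar c)) ++ map f (rev v)) [:: b].
  rewrite /= -!catA /= => <-; last by rewrite -!catA in wfs.
  rewrite -!catA in wfs.
  apply: (@fdwrithe_bigon n b c oC _
    ([:: b; c] ++ map f u ++ map f (rev w) ++ map f (rev v))) => //.
  + by exists [::], (map f u ++ map f (rev w) ++ map f (rev v)).
  + exists ([:: b; c] ++ map f u ++ map f (rev w)), (map f (rev v)).
    by rewrite -!catA.
  + move/flat_wf_uniq: wfs; rewrite -[_ :: _]/((c :: _) ++ _).
    rewrite !catA cats1 -rot1_cons rot_uniq -!catA //.
have -> : fdwrithe n (map f' ((u ++ [:: b]) ++
      rev (v ++ ord2 (~~ oC) c (bar b) ++ w ++ [:: bar c]))) =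
   fdwrithe n (map f' (u ++ rev w ++ rev v)).
  rewrite !rev_cat rev_ord2 /= !map_cat /= !map_cat map_ord2.
  rewrite fb2 fc2 fc4 /f' freorient_bar -/f' fb2 barK negbK.
  rewrite !rev_cat rev_ord2 /= !map_cat /= !map_cat map_ord2 in wfs'.
  rewrite fb2 fc2 fc4 /f' freorient_bar -/f' fb2 barK negbK in wfs'.
  rewrite ord2_sym in wfs' *.
  apply: (@fdwrithe_bigon n (bar b) (bar c) (~~ oC) _
    (map f' u ++ [:: bar b; bar c] ++ map f' (rev w) ++ map f' (rev v))) => //.
  + by exists (map f' u), (map f' (rev w) ++ map f' (rev v)).
  + exists (map f' u ++ [:: bar b; bar c] ++ map f' (rev w)), (map f' (rev v)).
    by rewrite !barK -!catA.
  + by rewrite /=; move: b2; case: (b.2) (c.2) => [] [].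
  + exact: flat_wf_uniq.
congr fdwrithe; apply/eq_in_map => z zin; rewrite ff //.
by move: zin; rewrite !mem_cat !mem_rev [(z \in w) || _]orbC.
Qed.

(** The case where one strand through [a] meets it first and the other one last:
    the smoothings agree up to a rotation and to the exchange of the names of [b]
    and [c]. *)
Lemma fdwrithe_fsmooth_tri_antiparallel n oC a b c u v w :
  tri true true oC a b c -> flat_wf (tri_word true true oC a b c u v w) ->
  fdwrithe n (fsmooth (tri_word false false (~~ oC) a b c u v w) a) =
  fdwrithe n (fsmooth (tri_word true true oC a b c u v w) a).
Proof.
case/and5P=> ab bc ca t1 t2; set k := tri_word _ _ _ _ _ _ _ _ _.
set k' := tri_word _ _ _ _ _ _ _ _ _ => wf.
have wf' : flat_wf k'.
  by move: wf; rewrite /k /k' (flat_wf_tri_word _ _ _ false false (~~ oC)).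
have un := flat_wf_uniq wf; have un' := flat_wf_uniq wf'.
have ak : a \in k by rewrite mem_head.
have ak' : a \in k' by rewrite !inE eqxx orbT.
have [fa fb fc] := tri_word_names un.
have := fb; rewrite !all_cat.
case/and3P=> /notin_names[bu bu'] /notin_names[bv bv'] /notin_names[bw bw'].
have := fc; rewrite !all_cat.
case/and3P=> /notin_names[cu cu'] /notin_names[cv cv'] /notin_names[cw cw'].
have [bc1 bc2 bc3 bc4] := name_neq bc.
have [cb1 cb2 cb3 cb4] : [/\ (c == b) = false, (c == bar b) = false,
      (bar c == b) = false & (bar c == bar b) = false].
  by apply: name_neq; rewrite eq_sym.
have memE := (in_cons, in_nil, mem_cat, mem_ord2, orbT, orbF,
  (bu, bu', bv, bv', bw, bw'), (cu, cu', cv, cv', cw, cw'),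
  (bc1, bc2, bc3, bc4), (cb1, cb2, cb3, cb4), (eqxx, bar_neq, neq_bar)).
have wfs := flat_wf_fsmooth wf ak; have wfs' := flat_wf_fsmooth wf' ak'.
have e1 : k = a :: (bar c :: u ++ [:: b]) ++ bar a :: (v ++ ord2 oC c (bar b) ++ w).
  by rewrite /= -catA.
have e2 : fsmooth k' a =
    fsmooth (a :: u ++ bar a :: (b :: v ++ ord2 (~~ oC) c (bar b) ++ w ++ [:: bar c])) a.
  have := @fsmooth_rot [:: bar c]
    (a :: u ++ [:: bar a, b & v ++ ord2 (~~ oC) c (bar b) ++ w]) a wf' ak'.
  by move=> <-; rewrite /= -!catA /= -!catA.
have un2 : uniq (a :: u ++ bar a :: (b :: v ++ ord2 (~~ oC) c (bar b) ++ w ++ [:: bar c])).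
  move: un'; rewrite -[k']/([:: bar c] ++
    (a :: u ++ [:: bar a, b & v ++ ord2 (~~ oC) c (bar b) ++ w])).
  by rewrite uniq_catC /= -!catA /= -!catA.
rewrite e2 fsmooth_head // in wfs' *.
rewrite e1 fsmooth_head -?e1 // in wfs *.
set f := freorient (v ++ ord2 oC c (bar b) ++ w) in wfs *.
set f' := freorient (b :: v ++ ord2 (~~ oC) c (bar b) ++ w ++ [:: bar c]) in wfs' *.
have fb1 : f b = bar b by apply: freorient_flip; rewrite !memE.
have fc1 : f (bar c) = c by rewrite /f freorient_flip ?barK // !memE.
have fb2 : f' b = b by apply: freorient_fix; rewrite !memE.
have fc2 : f' (bar c) = bar c by apply: freorient_fix; rewrite barK !memE.
have fc3 : f c = bar c by rewrite -{1}[c]barK /f freorient_bar -/f fc1.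
have fc4 : f' c = c by rewrite -{1}[c]barK /f' freorient_bar -/f' fc2 barK.
have ff : {in u ++ v ++ w, f =1 f'}.
  move=> z zin; rewrite /f /f'.
  move/allP: fb => /(_ z zin) zb; move/allP: fc => /(_ z zin) zc.
  rewrite (@freorient_skip (ord2 oC c (bar b)) (v ++ _) (v ++ w)); last first.
  - by case: (oC); rewrite /= ?[c.1 == _]eq_sym ?[b.1 == _]eq_sym ?zb ?zc.
  - move=> y; rewrite !(inE, mem_cat, mem_ord2).
    by case: (y == c) (y == bar b) (y \in v) => [] [] [].
  rewrite (@freorient_skip (b :: bar c :: ord2 (~~ oC) c (bar b)) (_ :: _) (v ++ w)) //.
  - move=> y; rewrite !(inE, mem_cat, mem_ord2).
    by case: (y == b) (y == bar c) (y == c) (y == bar b) (y \in v) (y \in w)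
      => [] [] [] [] [] [].
  - by case: (oC); rewrite /= ?[c.1 == _]eq_sym ?[b.1 == _]eq_sym ?zb ?zc.
have b2 : b.2 = c.2.
  by move: t1 t2; case: (a.2) (b.2) (c.2) (oC) => [] [] [] [].
have -> : map f ((bar c :: u ++ [:: b]) ++ rev (v ++ ord2 oC c (bar b) ++ w)) =
    c :: map f' u ++ bar b :: map f' (rev w) ++ ord2 oC b (bar c) ++ map f' (rev v).
  rewrite !rev_cat rev_ord2 /= !map_cat /= map_ord2 fc1 fb1 fc3 /f freorient_bar -/f fb1 barK.
  rewrite ord2_sym negbK -!catA /=.
  congr (_ :: _ ++ _ :: _ ++ _ ++ _); apply/eq_in_map => z zin; apply: ff;
    by move: zin; rewrite ?mem_rev !mem_cat => ->; rewrite ?orbT.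
have e' : map f' (u ++ rev (b :: v ++ ord2 (~~ oC) c (bar b) ++ w ++ [:: bar c])) =
    (map f' u ++ bar c :: map f' (rev w) ++ ord2 oC c (bar b) ++ map f' (rev v)) ++ [:: b].
  rewrite rev_cons !rev_cat rev_ord2 -cats1 negbK /= !map_cat /= !map_cat /=.
  by rewrite map_ord2 fc2 fb2 fc4 /f' freorient_bar -/f' fb2 -!catA /= -!catA.
rewrite {}e' in wfs' *.
rewrite -fdwrithe_rot //=.
(* exchange of the names of [b] and [c] *)
pose s d := if d == b.1 then c.1 else if d == c.1 then b.1 else d.
have s_inj : injective s.
  apply: inv_inj => d; rewrite /s.
  case: (d =P b.1) => [->|/eqP d1]; first by rewrite eq_sym (negPf bc) eqxx.
  case: (d =P c.1) => [->|/eqP d2]; first by rewrite eqxx.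
  by rewrite (negPf d1) (negPf d2).
have rid t : {subset t <= u ++ v ++ w} -> map (ren s) (map f' t) = map f' t.
  move=> sub; rewrite -map_comp; apply/eq_in_map => z /sub zin.
  rewrite /= /ren /s /=; move/allP: fb => /(_ z zin) /negPf ->.
  by move/allP: fc => /(_ z zin) /negPf ->.
have sb : ren s b = c by rewrite /ren /s eqxx b2 -surjective_pairing.
have sc : ren s c = b.
  by rewrite /ren /s eq_sym (negPf bc) eqxx -b2 -surjective_pairing.
have sbar x : ren s (bar x) = bar (ren s x) by [].
rewrite -(fdwrithe_ren n _ s_inj) /= !map_cat /= !map_cat map_ord2 !sbar sb sc !rid //.
- by move=> z zin; rewrite !mem_cat -[z \in v]mem_rev zin orbT.
- by move=> z zin; rewrite !mem_cat -[z \in w]mem_rev zin !orbT.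
- by move=> z zin; rewrite !mem_cat zin.
Qed.

Lemma tri_neg oA oB oC a b c : tri oA oB oC a b c -> tri (~~ oA) (~~ oB) (~~ oC) a b c.
Proof. by rewrite /tri !addbN !(inj_eq negb_inj). Qed.

Lemma fdwrithe_fsmooth_tri_self n oA oB oC a b c u v w :
  tri oA oB oC a b c -> flat_wf (tri_word oA oB oC a b c u v w) ->
  fdwrithe n (fsmooth (tri_word (~~ oA) (~~ oB) (~~ oC) a b c u v w) a) =
  fdwrithe n (fsmooth (tri_word oA oB oC a b c u v w) a).
Proof.
case: oA => t wf.
  by case: oB t wf => t wf;
    [apply: fdwrithe_fsmooth_tri_antiparallel|apply: fdwrithe_fsmooth_tri_parallel].
have := tri_neg t; move: wf; rewrite (flat_wf_tri_word _ _ _ true (~~ oB) (~~ oC)).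
rewrite -{4}[oC]negbK; case: oB {t} => wf t /=; symmetry.
  exact: fdwrithe_fsmooth_tri_parallel.
exact: fdwrithe_fsmooth_tri_antiparallel.
Qed.

(** * The polynomial of a flat word *)

(** The sign of a crossing, given its overpassage. *)
Definition key_sign (x : fletter) : int := if x.2 then 1 else -1.

(** The terms of the polynomial for the crossing with overpassage [x]. *)
Definition contrib (n : nat) (k : seq fletter) (x : fletter) : laurent :=
  let m := fdwrithe n (fsmooth k x) in
  let m0 := fdwrithe n k in
  monomial (key_sign x) (key_sign x * chord_index k x.1) m
  - monomial (key_sign x) 0 (if (m == m0) || (m == - m0) then m else m0).

(** The polynomial of a flat word [k] with list of overpassages [ov]. *)
Definition Fflat (n : nat) (k ov : seq fletter) : laurent :=
  \sum_(x <- ov) contrib n k x.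

Lemma contrib_eq n k k' x : chord_index k' x.1 = chord_index k x.1 ->
  fdwrithe n k' = fdwrithe n k ->
  fdwrithe n (fsmooth k' x) = fdwrithe n (fsmooth k x) -> contrib n k' x = contrib n k x.
Proof. by rewrite /contrib => -> -> ->. Qed.

Lemma Fflat_perm n k ov ov' : perm_eq ov ov' -> Fflat n k ov = Fflat n k ov'.
Proof. exact: perm_big. Qed.

Lemma Fflat_in n k k' ov : {in ov, contrib n k' =1 contrib n k} ->
  Fflat n k' ov = Fflat n k ov.
Proof. exact: eq_big_seq. Qed.

Lemma Fflat_eq n k k' ov ov' : perm_eq ov ov' ->
  {in ov, contrib n k' =1 contrib n k} -> Fflat n k' ov' = Fflat n k ov.
Proof. by move=> p h; rewrite -(Fflat_perm n k' p); apply: Fflat_in. Qed.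

Lemma Fflat_cons n k x ov : Fflat n k (x :: ov) = contrib n k x + Fflat n k ov.
Proof. exact: big_cons. Qed.

Lemma monomialN a i j : monomial (- a) i j = - monomial a i j.
Proof. by rewrite /monomial monalgUN. Qed.

Lemma key_sign_bar x : key_sign (bar x) = - key_sign x.
Proof. by case: x => c []; rewrite /key_sign /= ?opprK. Qed.

Lemma opprB_opp (V : zmodType) (a b : V) : - a - - b = - (a - b).
Proof. by rewrite opprD. Qed.

(** Opposite signs and [chord_index] mean equal indices. *)
Lemma contrib_opp n k x y : key_sign y = - key_sign x ->
  chord_index k y.1 = - chord_index k x.1 ->
  fdwrithe n (fsmooth k y) = fdwrithe n (fsmooth k x) -> contrib n k y = - contrib n k x.
Proof.
rewrite /contrib => -> -> ->; have -> (i j : int) : - i * - j = i * j by exact: mulrNN.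
rewrite !(monomialN (key_sign x)); exact: opprB_opp.
Qed.

Lemma contrib_eq0 n k x : chord_index k x.1 = 0 ->
  (fdwrithe n (fsmooth k x) == fdwrithe n k) || (fdwrithe n (fsmooth k x) == - fdwrithe n k) ->
  contrib n k x = 0.
Proof. by rewrite /contrib => -> ->; rewrite (mulr0 (key_sign x)); exact: subrr. Qed.

Lemma Fflat_rot n u v ov ov' : flat_wf (u ++ v) -> {subset ov <= u ++ v} ->
  perm_eq ov ov' -> Fflat n (v ++ u) ov' = Fflat n (u ++ v) ov.
Proof.
move=> wf sub p; apply: (Fflat_eq p) => x /sub xin.
by apply: contrib_eq; [exact: chord_index_rot|exact: fdwrithe_rot|rewrite (fsmooth_rot wf)].
Qed.

Lemma after_ren f k x : injective f ->
  after (map (ren f) k) (ren f x) = map (ren f) (after k x).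
Proof.
by move=> /ren_inj fi; rewrite /after index_map // map_cat map_drop map_take.
Qed.

Lemma strand_ren f k x : injective f ->
  strand (map (ren f) k) (ren f x) = map (ren f) (strand k x).
Proof.
move=> fi; rewrite /strand after_ren // map_take.
by rewrite -[bar (ren f x)]/(ren f (bar x)) index_map //; exact: ren_inj.
Qed.

Lemma fsmooth_ren f k x : injective f ->
  fsmooth (map (ren f) k) (ren f x) = map (ren f) (fsmooth k x).
Proof.
move=> fi; rewrite /fsmooth -[bar (ren f x)]/(ren f (bar x)) !strand_ren //.
rewrite -map_rev -map_cat -!map_comp; apply/eq_map => y /=.
rewrite /freorient /= -[bar (ren f y)]/(ren f (bar y)).
by rewrite !(mem_map (ren_inj fi)).
Qed.

Lemma Fflat_ren n f k ov : injective f ->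
  Fflat n (map (ren f) k) (map (ren f) ov) = Fflat n k ov.
Proof.
move=> fi; rewrite /Fflat big_map; apply: eq_bigr => x _.
by rewrite /contrib (fsmooth_ren _ _ fi) !(fdwrithe_ren _ _ fi) (chord_index_ren _ _ fi).
Qed.

Lemma Fflat_monogon n y u v ov ov' x :
  flat_wf (u ++ [:: y; bar y] ++ v) -> {subset ov <= u ++ v} ->
  x = y \/ x = bar y -> perm_eq (x :: ov) ov' ->
  Fflat n (u ++ [:: y; bar y] ++ v) ov' = Fflat n (u ++ v) ov.
Proof.
set k' := u ++ [:: y; bar y] ++ v; set k := u ++ v => wf' sub hx p.
have h : subst1 [::] [:: y; bar y] k k' by exists u, v.
have un := flat_wf_uniq wf'.
have pm : perm_eq k' ([:: y; bar y] ++ k) by apply: (subst1_perm h); rewrite cats0.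
have wf : flat_wf k := flat_wf_rem pm wf'.
have yk' : y \in k' by rewrite mem_cat inE eqxx orbT.
rewrite -(Fflat_perm n k' p) Fflat_cons contrib_eq0 ?add0r; last first.
- case: hx => ->; rewrite ?(fdwrithe_fsmooth_bar n wf' yk');
  by rewrite (fdwrithe_fsmooth_monogon_self n wf') ?opprK eqxx ?orbT.
- by case: hx => -> /=; rewrite (chord_index_monogon h un).
apply: Fflat_in => z /sub zk; apply: contrib_eq; last exact: (fdwrithe_fsmooth_monogon _ h).
- have zy : z.1 != y.1.
    have := un; rewrite (perm_uniq pm) cat_uniq => /and3P[_ /hasPn /(_ z zk)].
    by rewrite !inE eq_name.
  by rewrite (chord_index_ins h) //=; case: (y.2).
- exact: (fdwrithe_monogon _ h).
Qed.

Lemma Fflat_bigon n o p1 p2 u v w ov ov' :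
  flat_wf (u ++ [:: p1; p2] ++ v ++ ord2 o (bar p1) (bar p2) ++ w) ->
  flat_wf (u ++ v ++ w) ->
  p1.2 != p2.2 -> {subset ov <= u ++ v ++ w} ->
  perm_eq ([:: p1; p2] ++ ov) ov' \/ perm_eq ([:: bar p1; bar p2] ++ ov) ov' ->
  Fflat n (u ++ [:: p1; p2] ++ v ++ ord2 o (bar p1) (bar p2) ++ w) ov' =
  Fflat n (u ++ v ++ w) ov.
Proof.
set k2 := u ++ [:: p1; p2] ++ v ++ ord2 o (bar p1) (bar p2) ++ w.
set k0 := u ++ v ++ w => wf2 wf0 ne sub hp.
(* the word with the first strand of the bigon only *)
pose k1 := u ++ [:: p1; p2] ++ v ++ w.
have h1 : subst1 [::] [:: p1; p2] k0 k1 by exists u, (v ++ w).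
have h2 : subst1 [::] (ord2 o (bar p1) (bar p2)) k1 k2.
  by exists (u ++ [:: p1; p2] ++ v), w; rewrite -!catA.
have un := flat_wf_uniq wf2.
have [_ pm] := bigon_perm h1 h2.
have [cc opp] := chord_index_bigon h1 h2 ne un.
have [p1k p2k] : p1 \in k2 /\ p2 \in k2.
  by rewrite !(perm_mem pm) !inE !eqxx ?orbT.
have self : fdwrithe n (fsmooth k2 p2) = fdwrithe n (fsmooth k2 p1).
  rewrite -!(@fsmooth_rot u ([:: p1; p2] ++ v ++ ord2 o (bar p1) (bar p2) ++ w)) //.
  rewrite -!catA fdwrithe_fsmooth_bigon_self //.
  by move: wf2; rewrite /k2 flat_wf_rot -!catA.
have sgp : key_sign p2 = - key_sign p1.
  by rewrite /key_sign; move: ne; case: (p1.2) (p2.2) => [] [].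
have rest : Fflat n k2 ov = Fflat n k0 ov.
  apply: Fflat_in => z /sub zk.
  have := un; rewrite (perm_uniq pm) cat_uniq => /and3P[_ /hasPn /(_ z zk)].
  rewrite !inE !negb_or => /and4P[n1 n2 n3 n4] _.
  have x1 : z.1 != p1.1 by rewrite eq_name negb_or n1.
  have x2 : z.1 != p2.1 by rewrite eq_name negb_or n2.
  apply: contrib_eq; last exact: (fdwrithe_fsmooth_bigon _ h1 h2).
  - rewrite -(chord_index_ins h1) //.
    case: (o) h2 => h2; rewrite (chord_index_ins h2) //=;
      by move: ne; case: (p1.2) (p2.2) => [] [].
  - exact: (fdwrithe_bigon _ h1 h2).
case: hp => p; rewrite -(Fflat_perm n k2 p) /= !Fflat_cons rest.
  rewrite (contrib_opp sgp opp self); exact: addNKr.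
have -> : contrib n k2 (bar p2) = - contrib n k2 (bar p1).
  apply: contrib_opp; [by rewrite !key_sign_bar sgp|exact: opp|].
  by rewrite (fdwrithe_fsmooth_bar n wf2 p1k) (fdwrithe_fsmooth_bar n wf2 p2k) self.
exact: addNKr.
Qed.

Lemma tri_cycle oA oB oC a b c : tri oA oB oC a b c = tri oB oC oA b c a.
Proof.
rewrite /tri; case: (a.1 != b.1) (b.1 != c.1) (c.1 != a.1) => [] [] [] //=.
by case: (a.2) (b.2) (c.2) oA oB oC => [] [] [] [] [] [].
Qed.

Lemma tri_wordE oA oB oC a b c u v w :
  tri_word oA oB oC a b c u v w =
    (ord2 oA a (bar c) ++ u) ++ (ord2 oB b (bar a) ++ v ++ ord2 oC c (bar b) ++ w) /\
  tri_word oB oC oA b c a v w u =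
    (ord2 oB b (bar a) ++ v ++ ord2 oC c (bar b) ++ w) ++ (ord2 oA a (bar c) ++ u).
Proof. by rewrite /tri_word -!catA. Qed.

Lemma fdwrithe_fsmooth_tri_name n oA oB oC a b c u v w x :
  tri oA oB oC a b c -> flat_wf (tri_word oA oB oC a b c u v w) ->
  x.1 = a.1 ->
  fdwrithe n (fsmooth (tri_word (~~ oA) (~~ oB) (~~ oC) a b c u v w) x) =
  fdwrithe n (fsmooth (tri_word oA oB oC a b c u v w) x).
Proof.
move=> t wf /eqP; rewrite eq_name.
have wf' := wf; rewrite (flat_wf_tri_word _ _ _ (~~ oA) (~~ oB) (~~ oC)) in wf'.
have ain o1 o2 o3 : a \in tri_word o1 o2 o3 a b c u v w.
  by rewrite (perm_mem (tri_word_perm _ _ _ _ _ _ _ _ _)) mem_head.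
have self := fdwrithe_fsmooth_tri_self n t wf.
case/orP => /eqP ->; first exact: self.
rewrite (fdwrithe_fsmooth_bar n wf (ain _ _ _)).
by rewrite (fdwrithe_fsmooth_bar n wf' (ain _ _ _)) self.
Qed.

Lemma fdwrithe_fsmooth_tri_cycle n oA oB oC a b c u v w x :
  flat_wf (tri_word oA oB oC a b c u v w) ->
  x \in tri_word oA oB oC a b c u v w ->
  fdwrithe n (fsmooth (tri_word oB oC oA b c a v w u) x) =
  fdwrithe n (fsmooth (tri_word oA oB oC a b c u v w) x).
Proof. by have [-> ->] := tri_wordE oA oB oC a b c u v w => wf xin; rewrite fsmooth_rot. Qed.

Lemma flat_wf_tri_cycle oA oB oC a b c u v w :
  flat_wf (tri_word oB oC oA b c a v w u) =
  flat_wf (tri_word oA oB oC a b c u v w).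
Proof. by have [-> ->] := tri_wordE oA oB oC a b c u v w; rewrite flat_wf_rot. Qed.

Lemma mem_tri_cycle oA oB oC a b c u v w :
  tri_word oB oC oA b c a v w u =i tri_word oA oB oC a b c u v w.
Proof.
by have [-> ->] := tri_wordE oA oB oC a b c u v w => x; rewrite mem_cat orbC -mem_cat.
Qed.

Lemma Fflat_tri_word n oA oB oC a b c u v w ov ov' :
  tri oA oB oC a b c -> flat_wf (tri_word oA oB oC a b c u v w) ->
  {subset ov <= tri_word oA oB oC a b c u v w} -> perm_eq ov ov' ->
  Fflat n (tri_word (~~ oA) (~~ oB) (~~ oC) a b c u v w) ov' =
  Fflat n (tri_word oA oB oC a b c u v w) ov.
Proof.
move=> t wf sub p; have un := flat_wf_uniq wf.
have fl : tri_flip oA oB oC a b c (tri_word oA oB oC a b c u v w)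
   (tri_word (~~ oA) oB oC a b c u v w) (tri_word (~~ oA) (~~ oB) oC a b c u v w)
   (tri_word (~~ oA) (~~ oB) (~~ oC) a b c u v w).
  split.
  - by exists [::], (u ++ ord2 oB b (bar a) ++ v ++ ord2 oC c (bar b) ++ w).
  - by exists (ord2 (~~ oA) a (bar c) ++ u), (v ++ ord2 oC c (bar b) ++ w);
       rewrite -!catA.
  - by exists (ord2 (~~ oA) a (bar c) ++ u ++ ord2 (~~ oB) b (bar a) ++ v), w;
       rewrite -!catA.
have wf' := wf; rewrite (flat_wf_tri_word _ _ _ (~~ oA) (~~ oB) (~~ oC)) in wf'.
apply: (Fflat_eq p) => x /sub xin; apply: contrib_eq.
- exact: chord_index_tri t fl un.
- exact: fdwrithe_tri t fl un.
have xin' : x \in tri_word (~~ oA) (~~ oB) (~~ oC) a b c u v w.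
  by move: xin; rewrite !(perm_mem (tri_word_perm _ _ _ _ _ _ _ _ _)).
have [/eqP xa|xa] := boolP (x.1 == a.1); first exact: fdwrithe_fsmooth_tri_name.
have [/eqP xb|xb] := boolP (x.1 == b.1).
  rewrite -(fdwrithe_fsmooth_tri_cycle n wf xin) -(fdwrithe_fsmooth_tri_cycle n wf' xin').
  apply: fdwrithe_fsmooth_tri_name xb; last by rewrite flat_wf_tri_cycle.
  by rewrite -(tri_cycle oA).
have [/eqP xc|xc] := boolP (x.1 == c.1); last first.
  exact: fdwrithe_fsmooth_tri t fl wf xin xa xb xc.
rewrite -(fdwrithe_fsmooth_tri_cycle n wf xin) -(fdwrithe_fsmooth_tri_cycle n wf' xin').
rewrite -(mem_tri_cycle) in xin; rewrite -(mem_tri_cycle) in xin'.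
rewrite -flat_wf_tri_cycle in wf; rewrite -flat_wf_tri_cycle in wf'.
rewrite -(fdwrithe_fsmooth_tri_cycle n wf xin) -(fdwrithe_fsmooth_tri_cycle n wf' xin').
apply: fdwrithe_fsmooth_tri_name xc; last by rewrite flat_wf_tri_cycle.
by rewrite -(tri_cycle oB) -(tri_cycle oA).
Qed.

Lemma Fflat_tri n oA oB oC a b c u v w z ov ov' :
  let k o1 o2 o3 := u ++ ord2 o1 a (bar c) ++ v ++ ord2 o2 b (bar a) ++ w ++
                    ord2 o3 c (bar b) ++ z in
  tri oA oB oC a b c -> flat_wf (k oA oB oC) ->
  {subset ov <= k oA oB oC} -> perm_eq ov ov' ->
  Fflat n (k (~~ oA) (~~ oB) (~~ oC)) ov' = Fflat n (k oA oB oC) ov.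
Proof.
move=> k t wf sub p.
pose k0 o1 o2 o3 := ord2 o1 a (bar c) ++ v ++ ord2 o2 b (bar a) ++ w ++
                    ord2 o3 c (bar b) ++ z.
have kr o1 o2 o3 : k0 o1 o2 o3 ++ u = tri_word o1 o2 o3 a b c v w (z ++ u).
  by rewrite /k0 /tri_word -!catA.
have wfr o1 o2 o3 : flat_wf (u ++ k0 o1 o2 o3) = flat_wf (tri_word o1 o2 o3 a b c v w (z ++ u)).
  by rewrite flat_wf_rot kr.
have wf' : flat_wf (tri_word oA oB oC a b c v w (z ++ u)) by rewrite -wfr.
have sub' : {subset ov <= tri_word oA oB oC a b c v w (z ++ u)}.
  by move=> x /sub; rewrite -kr /k -/(k0 oA oB oC) mem_cat orbC -mem_cat.
have sub2 : {subset ov' <= u ++ k0 (~~ oA) (~~ oB) (~~ oC)}.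
  move=> x; rewrite -(perm_mem p) => /sub'.
  have -> : (x \in u ++ k0 (~~ oA) (~~ oB) (~~ oC)) =
            (x \in tri_word (~~ oA) (~~ oB) (~~ oC) a b c v w (z ++ u)).
    by rewrite -kr !(mem_cat x) orbC.
  by rewrite !(perm_mem (tri_word_perm _ _ _ _ _ _ _ _ _)).
have wf2 : flat_wf (u ++ k0 (~~ oA) (~~ oB) (~~ oC)).
  by rewrite wfr (flat_wf_tri_word _ _ _ oA oB oC).
have e1 := Fflat_rot n wf2 sub2 (perm_refl ov').
have e2 := Fflat_rot n wf sub (perm_refl ov).
apply: (etrans (esym e1)); apply: (etrans _ e2).
rewrite -[LHS]/(Fflat n (k0 _ _ _ ++ u) ov') -[RHS]/(Fflat n (k0 _ _ _ ++ u) ov) !kr.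
exact: Fflat_tri_word t wf' sub' p.
Qed.

(** * From words to flat words *)

(** A letter without its level. *)
Definition key (x : letter) : fletter := (name x, ltr x).

(** The classical letters of a word, without their levels. *)
Definition flat (w : seq letter) : seq fletter :=
  [seq key x | x <- w & is_classical x].

(** The overpassages, as passages of the flat word. *)
Definition over_keys (w : seq letter) : seq fletter :=
  [seq key x | x <- w & is_over x].

Lemma flat_cat u v : flat (u ++ v) = flat u ++ flat v.
Proof. by rewrite /flat filter_cat map_cat. Qed.

Lemma over_keys_cat u v : over_keys (u ++ v) = over_keys u ++ over_keys v.
Proof. by rewrite /over_keys filter_cat map_cat. Qed.

Lemma flat_cons x v : is_classical x -> flat (x :: v) = key x :: flat v.
Proof. by rewrite /flat /= => ->. Qed.

Lemma flat_rev u : flat (rev u) = rev (flat u).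
Proof. by rewrite /flat filter_rev map_rev. Qed.

Lemma over_classical x : is_over x -> is_classical x.
Proof. by rewrite /is_over /is_classical => /eqP ->. Qed.

Lemma paired_sym x y : paired x y = paired y x.
Proof.
by rewrite /paired eq_sym; case: (lev x) (lev y) => [] [].
Qed.

Lemma paired_ltr x y : paired x y -> ltr y = ~~ ltr x.
Proof. by case/andP; case: (ltr x) (ltr y) => [] []. Qed.

Lemma paired_key x y : paired x y -> name y = name x -> key y = bar (key x).
Proof. by move=> /paired_ltr e en; rewrite /key /bar e en. Qed.

Lemma paired_classical x y : paired x y -> is_classical y = is_classical x.
Proof. by rewrite /paired /is_classical andbC; case: (lev x) (lev y) => [] []. Qed.

Lemma paired_over x y : paired x y -> is_classical x -> is_over y = ~~ is_over x.
Proof.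
by rewrite /paired /is_classical /is_over andbC; case: (lev x) (lev y) => [] [].
Qed.

Lemma well_formed_uniq w : well_formed w -> uniq w.
Proof.
move=> wf; apply: count_mem_uniq => x.
have [xw|xw] := boolP (x \in w); last by apply/count_memPn.
have [y [z [e /paired_ltr yz]]] := well_formedP wf xw.
have : count_mem x w = count_mem x [seq u <- w | name u == name x].
  rewrite count_filter; apply: eq_count => u /=.
  by case: eqP => // ->; rewrite eqxx.
move=> ->; have : x \in [:: y; z] by rewrite -e mem_filter eqxx.
have nyz : y != z by apply: contra_eqN yz => /eqP ->; case: (ltr z).
rewrite e /= !inE; case/orP => /eqP ex; rewrite ex eqxx.
  by rewrite eq_sym (negPf nyz).
by rewrite (negPf nyz).
Qed.

(** The other passage through the double point of [x]. *)
Lemma mateP w x : well_formed w -> x \in w ->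
  exists y, [/\ y \in w, paired x y, name y = name x &
    forall z, z \in w -> name z = name x -> z = x \/ z = y].
Proof.
move=> wf xw; have [y [z [e yz]]] := well_formedP wf xw.
have mem u : (u \in w) && (name u == name x) = (u \in [:: y; z]).
  by rewrite -e mem_filter andbC.
have [/andP[yw /eqP ny] /andP[zw /eqP nz]] :
    (y \in w) && (name y == name x) /\ (z \in w) && (name z == name x).
  by rewrite !mem !inE !eqxx orbT.
have := mem x; rewrite xw eqxx !inE => /esym/orP[] /eqP ex.
  exists z; split=> //; first by rewrite ex.
  move=> u uw /eqP nu; have := mem u; rewrite uw nu !inE ex.
  by case/esym/orP => /eqP ->; [left|right].
exists y; split=> //; first by rewrite ex paired_sym.
move=> u uw /eqP nu; have := mem u; rewrite uw nu !inE ex.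
by case/esym/orP => /eqP ->; [right|left].
Qed.

Lemma paired_same_name w x y : well_formed w -> x \in w -> y \in w ->
  name y = name x -> x != y -> paired x y.
Proof.
move=> wf xw yw en ne; have [z [_ xz _ /(_ y yw en)]] := mateP wf xw.
by case=> [e|-> //]; rewrite e eqxx in ne.
Qed.

Lemma key_inj w : well_formed w -> {in w &, injective key}.
Proof.
move=> wf x y xw yw [en el]; apply/eqP; apply/negPn/negP => ne.
have := paired_ltr (paired_same_name wf xw yw (esym en) ne).
by rewrite el; case: (ltr y).
Qed.

Lemma flat_wf_flat w : well_formed w -> flat_wf (flat w).
Proof.
move=> wf; apply/andP; split.
  rewrite map_inj_in_uniq ?filter_uniq ?well_formed_uniq //.
  move=> x y; rewrite !mem_filter => /andP[_ xw] /andP[_ yw].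
  exact: key_inj xw yw.
apply/allP => _ /mapP[x + ->]; rewrite mem_filter => /andP[xc xw].
have [y [yw xy en _]] := mateP wf xw.
by rewrite -(paired_key xy en) map_f // mem_filter (paired_classical xy) xc.
Qed.

Lemma mem_flat w t z : well_formed w -> {subset t <= w} -> z \in w ->
  is_classical z -> (key z \in flat t) = (z \in t).
Proof.
move=> wf sub zw zc; apply/idP/idP => [/mapP[y]|zt].
  rewrite mem_filter => /andP[_ yt] /(key_inj wf zw (sub _ yt)) -> //.
by rewrite map_f // mem_filter zc.
Qed.

Lemma over_keys_sub w : {subset over_keys w <= flat w}.
Proof.
move=> _ /mapP[x + ->]; rewrite mem_filter => /andP[xo xw].
by rewrite map_f // mem_filter over_classical.
Qed.

Lemma sum_step w : \sum_(x <- w) step x = ftotal (flat w).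
Proof.
rewrite /ftotal /flat big_map big_filter [RHS]big_mkcond /=.
by apply: eq_bigr => x _; rewrite /step /is_virt /is_classical; case: eqP.
Qed.

Lemma label_find w x : well_formed w -> x \in w -> is_classical x ->
  label w (find (fun y => key y == key x) w) = flabel (flat w) (key x).
Proof.
move=> wf xw xc; have inj := key_inj wf.
have -> : find (fun y => key y == key x) w = index x w.
  by apply: eq_in_find => y yw /=; rewrite (inj_in_eq inj).
have un := well_formed_uniq wf; have unk := flat_wf_uniq (flat_wf_flat wf).
move: un unk; case/splitPr: xw => u v un.
rewrite flat_cat flat_cons // => /uniq_mid[xu _].
rewrite flabel_mid // /label index_mid ?take_size_cat ?sum_step //.
by have [] := uniq_mid un.
Qed.

Lemma label_key w x b : well_formed w -> x \in w -> is_classical x ->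
  label w (find (fun y => (name y == name x) && (ltr y == b)) w) =
  flabel (flat w) (name x, b).
Proof.
move=> wf xw xc; have [y [yw xy en _]] := mateP wf xw.
have [z [zw zc ez]] : exists z, [/\ z \in w, is_classical z & key z = (name x, b)].
  have [e|ne] := eqVneq (ltr x) b; first by exists x; rewrite /key e.
  exists y; rewrite (paired_classical xy) /key (paired_ltr xy) en; split=> //.
  by case: (ltr x) b ne => [] [].
by rewrite -ez -label_find // ez.
Qed.

Lemma csignE w x : well_formed w -> x \in w -> is_over x ->
  csign w (name x) = key_sign (key x).
Proof.
move=> wf xw xo; rewrite /csign /key_sign /=; congr (if _ then _ else _).
apply/hasP/idP => [[y yw /and3P[/eqP en yo yl]]|xl]; last first.
  by exists x; rewrite ?eqxx ?xo.
have [z [_ xz _ h]] := mateP wf xw.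
have := paired_over xz (over_classical xo); rewrite xo /=.
by case: (h y yw en) => e; [rewrite -e|rewrite -e yo].
Qed.

Lemma crossing_indexE w x : well_formed w -> x \in w -> is_over x ->
  crossing_index w (name x) = key_sign (key x) * chord_index (flat w) (name x).
Proof.
move=> wf xw xo; have xc := over_classical xo.
rewrite /crossing_index csignE // /chord_index -!label_key // /in_left /in_right.
rewrite (eq_find (a2 := fun y => (name y == name x) && (ltr y == true))); last first.
  by move=> y /=; rewrite eqb_id.
rewrite (eq_find (a1 := fun y => (name y == name x) && ~~ ltr y)
  (a2 := fun y => (name y == name x) && (ltr y == false))) //.
by move=> y /=; rewrite eqbF_neg.
Qed.

Lemma key_sign_jump n x (i : int) :
  key_sign x * ((key_sign x * i == n%:Z)%:R - (key_sign x * i == - n%:Z)%:R) = jump n i.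
Proof.
rewrite -/(jump n (key_sign x * i)) /key_sign; case: ifP => _; first by rewrite !mul1r.
by rewrite !mulN1r jumpN opprK.
Qed.

(** The sum over the overpassages and the sum over the passages from left to right
    are both sums over the crossings. *)
Lemma dwritheE w n : well_formed w -> dwrithe w n = fdwrithe n (flat w).
Proof.
move=> wf; pose k := flat w.
have wrE i : writhe w i =
    \sum_(x <- w | is_over x)
      key_sign (key x) * (key_sign (key x) * chord_index k (name x) == i)%:R.
  rewrite /writhe /classical big_map big_filter_cond big_mkcondr /=.
  rewrite big_seq_cond [RHS]big_seq_cond; apply: eq_bigr => x /andP[xw xo].
  rewrite crossing_indexE // csignE //.
  by case: eqP; rewrite ?mulr1 ?mulr0.
have -> : dwrithe w n = \sum_(x <- w | is_over x) jump n (chord_index k (name x)).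
  rewrite /dwrithe !wrE -sumrB; apply: eq_bigr => x _.
  by rewrite -mulrBr key_sign_jump.
rewrite /fdwrithe -/k -big_filter -(big_filter k).
rewrite -(big_map name predT (fun c => jump n (chord_index k c))).
rewrite -(big_map fst predT (fun c => jump n (chord_index k c))).
apply: perm_big; apply: uniq_perm.
- rewrite map_inj_in_uniq ?filter_uniq ?well_formed_uniq // => x y.
  rewrite !mem_filter => /andP[xo xw] /andP[yo yw] en; apply/eqP/negPn/negP => ne.
  have := paired_over (paired_same_name wf xw yw (esym en) ne) (over_classical xo).
  by rewrite xo yo.
- rewrite map_inj_in_uniq ?filter_uniq ?(flat_wf_uniq (flat_wf_flat wf)) //.
  move=> [c b] [d e]; rewrite !mem_filter /= => /andP[hb _] /andP[he _] ->.
  by rewrite hb he.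
move=> c; apply/mapP/mapP => [[x]|[x]]; rewrite mem_filter => /andP[].
  move=> xo xw ->; have xc := over_classical xo.
  exists (name x, true) => //; rewrite mem_filter /=.
  apply: (@mem_ends k (key x)); first exact: flat_wf_flat.
  by rewrite map_f // mem_filter xc.
move=> _ /mapP[y +] -> ->; rewrite mem_filter => /andP[yc yw].
have [z [zw yz en _]] := mateP wf yw.
have := paired_over yz yc; case yo: (is_over y) => /= zo.
  by exists y; rewrite // mem_filter yo.
by exists z; rewrite ?en // mem_filter zo.
Qed.

(** The result of [smooth] in terms of the factors of the word. *)
Lemma smoothE p q r x y c : name x = c -> name y = c ->
  all (fun z => name z != c) (p ++ q) ->
  smooth (p ++ x :: q ++ y :: r) c =
  if is_over x then map (reorient (r ++ p)) (rev r ++ q ++ rev p)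
  else map (reorient q) (p ++ rev q ++ r).
Proof.
move=> nx ny; rewrite all_cat => /andP[hp hq].
have f1 s t z : name z = c -> all (fun z => name z != c) s ->
    find (fun u => name u == c) (s ++ z :: t) = size s.
  move=> nz hs; have /negPf hh : ~~ has (fun u => name u == c) s by rewrite -all_predC.
  by rewrite find_cat hh /= nz eqxx addn0.
have d1 (s t : seq letter) z : drop (size s).+1 (s ++ z :: t) = t.
  by rewrite -cat_rcons -(size_rcons s z) drop_size_cat.
have t1 (s t : seq letter) z : take (size s).+1 (s ++ z :: t) = rcons s z.
  by rewrite -cat_rcons -(size_rcons s z) take_size_cat.
rewrite /smooth !(f1 _ _ _ nx hp) !d1 !(f1 _ _ _ ny hq) d1 t1 !take_size_cat //.
rewrite has_rcons nx eqxx /=; case: is_over => //=; rewrite ifN //.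
apply/hasPn => z zp; move/allP: hp => /(_ z zp); apply: contra.
by case/andP.
Qed.

Lemma key_reorient w t z : well_formed w -> uniq t -> {subset t <= w} ->
  z \in w -> is_classical z -> key (reorient t z) = freorient (flat t) (key z).
Proof.
move=> wf un sub zw zc; have [y [yw zy en h]] := mateP wf zw.
rewrite /reorient /freorient /key /= -/(key z) -(paired_key zy en).
rewrite !(mem_flat wf) ?(paired_classical zy) //; congr (_, _ (+) _).
have -> : count (fun u => name u == name z) t = ((z \in t) + (y \in t))%N.
  rewrite -!count_uniq_mem // -count_predUI.
  have -> : count (predI (pred1 z) (pred1 y)) t = 0%N.
    apply/eqP; rewrite eqn0Ngt -has_count; apply/hasPn => u _ /=.
    apply/negP => /andP[/eqP -> /eqP e].
    by have := paired_ltr zy; rewrite e; case: (ltr y).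
  rewrite addn0; apply: eq_in_count => u ut /=; apply/eqP/orP => [/(h u (sub u ut))|].
    by case=> ->; rewrite eqxx; [left|right].
  by case=> /eqP ->.
by case: (z \in t) (y \in t) => [] [].
Qed.

Lemma flat_map_reorient w t s : well_formed w -> uniq t -> {subset t <= w} ->
  {subset s <= w} -> flat (map (reorient t) s) = map (freorient (flat t)) (flat s).
Proof.
move=> wf un sub; rewrite /flat filter_map -!map_comp => subs.
apply/eq_in_map => z; rewrite mem_filter => /andP[zc zs] /=.
by rewrite (key_reorient wf) // subs.
Qed.

Lemma well_formed_perm w w' : perm_eq w w' -> well_formed w -> well_formed w'.
Proof.
move=> p wf; apply/allP => x; rewrite -(perm_mem p) => xw.
have [y [z [e yz]]] := well_formedP wf xw.
have := perm_filter (fun u => name u == name x) p; rewrite e.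
case: filter => [|y' [|z' [|u t]]]; try by move/perm_size.
move=> pp; have : y' \in [:: y; z] by rewrite (perm_mem pp) mem_head.
rewrite !inE; case/orP => /eqP ey; subst y'.
  by move: pp; rewrite perm_cons => /perm_mem /(_ z); rewrite !inE eqxx => /esym/eqP <-.
move: pp; rewrite (perm_catC [:: y] [:: z]) perm_cons => /perm_mem /(_ y).
by rewrite !inE eqxx => /esym/eqP <-; rewrite paired_sym.
Qed.

Lemma well_formed_rem w c : well_formed w -> well_formed [seq z <- w | name z != c].
Proof.
move=> wf; apply/allP => x; rewrite mem_filter => /andP[xc xw].
have [y [z [e yz]]] := well_formedP wf xw.
rewrite -filter_predI (eq_filter (a2 := fun u => name u == name x)) ?e //.
by move=> u /=; case: eqP => // ->; rewrite xc.
Qed.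

Lemma well_formed_reorient t w : well_formed w -> well_formed (map (reorient t) w).
Proof.
move=> wf; apply/allP => _ /mapP[x xw ->].
have [y [z [e yz]]] := well_formedP wf xw.
have : (y \in [:: y; z]) && (z \in [:: y; z]) by rewrite !inE !eqxx orbT.
rewrite -e !mem_filter => /andP[/andP[/eqP ny _] /andP[/eqP nz _]].
rewrite filter_map (eq_filter (a2 := fun u => name u == name x)) // e /=.
move: yz; rewrite /paired /reorient /= ny nz.
by case: (ltr y) (ltr z) (_ == 1%N) => [] [] [].
Qed.

Lemma filter_names c s : all (fun z : letter => name z != c) s ->
  [seq z <- s | name z != c] = s.
Proof. by move/all_filterP. Qed.

Lemma perm_mid2 (T : eqType) (p q r : seq T) x y :
  perm_eq (p ++ x :: q ++ y :: r) ([:: x; y] ++ p ++ q ++ r).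
Proof. by apply/permP => a; rewrite !count_cat /= !count_cat /=; lia. Qed.

Lemma perm_rev_outer (T : eqType) (p q r : seq T) :
  perm_eq (p ++ q ++ r) (rev r ++ q ++ rev p).
Proof. by apply/permP => a; rewrite !count_cat !count_rev; lia. Qed.

(** [smooth] keeps the base point whereas [fsmooth] starts at the smoothed
    crossing: the two words differ by a rotation. *)
Lemma dwrithe_smooth w n x : well_formed w -> x \in w -> is_over x ->
  dwrithe (smooth w (name x)) n = fdwrithe n (fsmooth (flat w) (key x)).
Proof.
move=> wf xw xo; have xc := over_classical xo.
have [y [yw xy en h]] := mateP wf xw.
have yo : ~~ is_over y by rewrite (paired_over xy xc) xo.
have yc : is_classical y by rewrite (paired_classical xy).
have un := well_formed_uniq wf; have wfk := flat_wf_flat wf.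
have unk := flat_wf_uniq wfk.
have xk : key x \in flat w by rewrite map_f // mem_filter xc.
have yx : y != x by apply: contraNneq yo => ->.
have ky := paired_key xy en.
have names s : {subset s <= w} -> x \notin s -> y \notin s ->
    all (fun z => name z != name x) s.
  move=> sub xs ys; apply/allP => z zs; apply/eqP => e.
  by case: (h z (sub z zs) e) => ez; rewrite ez in zs; rewrite zs in xs ys.
have [p [q [r e]]] : exists p q r, w = p ++ x :: q ++ y :: r \/ w = p ++ y :: q ++ x :: r.
  case/splitPr: xw yw => u v; rewrite mem_cat inE (negPf yx) /=.
  case/orP => /splitPr[a b]; first by exists a, b, v; right; rewrite -catA.
  by exists u, a, b; left.
have nxy z1 z2 : w = p ++ z1 :: q ++ z2 :: r ->
    [/\ z1 \notin p ++ q ++ r, z2 \notin p ++ q ++ r, {subset p ++ q ++ r <= w} &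
        uniq (p ++ q ++ r)].
  move=> ew; have pm : perm_eq w ([:: z1; z2] ++ (p ++ q ++ r)).
    by rewrite ew perm_mid2.
  have := un; rewrite (perm_uniq pm) cat_uniq => /and3P[_ /hasPn hn unr].
  split=> //; last by move=> z zin; rewrite (perm_mem pm) mem_cat zin orbT.
  - by apply/negP => /hn; rewrite !inE eqxx.
  - by apply/negP => /hn; rewrite !inE eqxx orbT.
have [xn [yn [sub [unr ew]]]] : x \notin p ++ q ++ r /\ y \notin p ++ q ++ r /\
    {subset p ++ q ++ r <= w} /\ uniq (p ++ q ++ r) /\
    [seq z <- w | name z != name x] = p ++ q ++ r.
  have flt : x \notin p ++ q ++ r -> y \notin p ++ q ++ r -> {subset p ++ q ++ r <= w} ->
      [seq z <- p ++ q ++ r | name z != name x] = p ++ q ++ r.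
    by move=> a b sub; apply: filter_names; apply: names.
  by case: e => e; have [n1 n2 sub unr] := nxy _ _ e; do !split => //;
    rewrite -[RHS]flt // e !filter_cat /= filter_cat /= en eqxx.
have nall := names _ sub xn yn.
have npq : all (fun z => name z != name x) (p ++ q).
  by move: nall; rewrite !all_cat => /and3P[-> -> _].
have subs s : {subset s <= p ++ q ++ r} -> {subset s <= w}.
  by move=> hs z /hs /sub.
have [uq urp] : uniq q /\ uniq (r ++ p).
  move: unr; rewrite uniq_catCA cat_uniq => /and3P[-> _].
  by rewrite uniq_catC.
have wfs t s : perm_eq (p ++ q ++ r) s -> well_formed (map (reorient t) s).
  move=> ps; apply: well_formed_reorient; apply: (well_formed_perm ps).
  by rewrite -ew; apply: well_formed_rem.
have wff := flat_wf_fsmooth wfk xk.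
case: e => e.
- have es : smooth w (name x) = map (reorient (r ++ p)) (rev r ++ q ++ rev p).
    by rewrite e smoothE // xo.
  have ps : perm_eq (p ++ q ++ r) (rev r ++ q ++ rev p).
    exact: perm_rev_outer.
  rewrite es dwritheE ?wfs // (flat_map_reorient wf) //; first last.
  + by apply: subs => z; rewrite (perm_mem ps).
  + by apply: subs => z; rewrite !mem_cat => /orP[] ->; rewrite ?orbT.
  rewrite !flat_cat !flat_rev.
  have [||s1 s2] := @strands_eq (flat p) (flat (x :: q ++ y :: r)) (key x)
    (flat q) (flat r ++ flat p).
  + by rewrite -flat_cat -e.
  + by rewrite flat_cons // flat_cat flat_cons // ky /= -catA.
  have fe : flat p ++ flat (x :: q ++ y :: r) = flat w by rewrite -flat_cat -e.
  rewrite fe in s1 s2; rewrite /fsmooth s1 s2 in wff *.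
  rewrite rev_cat catA map_cat in wff *.
  by rewrite -fdwrithe_rot // -map_cat.
- have es : smooth w (name x) = map (reorient q) (p ++ rev q ++ r).
    by rewrite e smoothE // (negPf yo).
  have ps : perm_eq (p ++ q ++ r) (p ++ rev q ++ r).
    by rewrite perm_cat2l perm_cat2r perm_sym perm_rev.
  rewrite es dwritheE ?wfs // (flat_map_reorient wf) //; first last.
  + by apply: subs => z; rewrite (perm_mem ps).
  + by apply: subs => z zq; rewrite !mem_cat zq orbT.
  rewrite !flat_cat !flat_rev.
  have [||s1 s2] := @strands_eq (flat (p ++ y :: q)) (flat (x :: r)) (key x)
    (flat r ++ flat p) (flat q).
  + by rewrite -flat_cat -catA -e.
  + by rewrite flat_cons // flat_cat flat_cons // ky /= -catA.
  have fe : flat (p ++ y :: q) ++ flat (x :: r) = flat w.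
    by rewrite -flat_cat -catA -e.
  rewrite fe in s1 s2; rewrite /fsmooth s1 s2 in wff *.
  rewrite -catA map_cat in wff *.
  by rewrite -fdwrithe_rot // -map_cat -!catA.
Qed.

Lemma sum_term (V : zmodType) (I : eqType) (s : seq I) (P : pred I) (A B C G : I -> V) :
  (forall x, x \in s -> G x = A x - (if P x then B x else C x)) ->
  \sum_(x <- s) A x - \sum_(x <- s | P x) B x - \sum_(x <- s | ~~ P x) C x =
  \sum_(x <- s) G x.
Proof.
move=> h; rewrite (big_mkcond P) (big_mkcond (fun x => ~~ P x)) -!sumrB.
rewrite big_seq [RHS]big_seq; apply: eq_bigr => x /h ->.
by case: (P x); rewrite /= ?subr0.
Qed.

Lemma FpolyE n D : Fpoly n D = Fflat n (flat (word D)) (over_keys (word D)).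
Proof.
set w := word D; have wf : well_formed w := word_well_formed D.
rewrite /Fpoly -/w /classical /Fflat /over_keys 4!big_map.
apply: sum_term => x; rewrite mem_filter => /andP[xo xw].
rewrite /contrib csignE // crossing_indexE // dwrithe_smooth // dwritheE //.
rewrite /in_T dwrithe_smooth // dwritheE //.
by case: ifP.
Qed.

(** * Invariance under the moves *)

(** The polynomial of a word, see [FpolyE]. *)
Definition Fword (n : nat) (w : seq letter) : laurent := Fflat n (flat w) (over_keys w).

Lemma Fword_flat n w w' : flat w = flat w' -> over_keys w = over_keys w' ->
  Fword n w = Fword n w'.
Proof. by rewrite /Fword => -> ->. Qed.

Lemma flat_virt s : all is_virt s -> flat s = [::] /\ over_keys s = [::].
Proof.
elim: s => // x s IH /= /andP[/eqP xv /IH[e1 e2]].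
by rewrite /flat /over_keys /= /is_classical /is_over xv.
Qed.

Lemma both_virt p : both is_virt p -> flat (seg p) = [::] /\ over_keys (seg p) = [::].
Proof. by move=> h; apply: flat_virt; rewrite /= andbT. Qed.

Lemma flat_seg p : both is_classical p -> flat (seg p) = [:: key p.1; key p.2].
Proof. by case/andP=> h1 h2; rewrite /flat /= h1 h2. Qed.

Lemma Fword_rename n f w : injective f -> Fword n (map (rename f) w) = Fword n w.
Proof.
move=> fi; rewrite /Fword -(Fflat_ren n (flat w) (over_keys w) fi).
have -> : flat (map (rename f) w) = map (ren f) (flat w).
  by rewrite /flat filter_map -!map_comp.
have -> : over_keys (map (rename f) w) = map (ren f) (over_keys w).
  by rewrite /over_keys filter_map -!map_comp.
exact: erefl.
Qed.

Lemma Fword_rot n e w : well_formed w -> Fword n (rot e w) = Fword n w.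
Proof.
move=> wf; have wfk := flat_wf_flat wf; have sub := @over_keys_sub w.
rewrite -[X in _ = Fword n X](cat_take_drop e w) /rot /Fword !flat_cat !over_keys_cat.
rewrite -(cat_take_drop e w) flat_cat over_keys_cat in wfk sub.
by apply: (Fflat_rot n wfk sub); rewrite perm_catC.
Qed.

Lemma Fword_monogon n u v p : well_formed (u ++ seg p ++ v) -> monogon p ->
  both is_classical p || both is_virt p -> Fword n (u ++ seg p ++ v) = Fword n (u ++ v).
Proof.
move=> wf mp; case/orP=> [pc|/both_virt[f o]]; last first.
  by apply: Fword_flat; rewrite ?flat_cat ?over_keys_cat ?f ?o.
have wfk := flat_wf_flat wf; have un := well_formed_uniq wf.
have en : name p.2 = name p.1.
  by case: mp => [[] /andP[/eqP /= e _]].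
have [m1 m2] : p.1 \in u ++ seg p ++ v /\ p.2 \in u ++ seg p ++ v.
  by rewrite !(mem_cat, inE) !eqxx !orbT.
have ne : p.1 != p.2.
  have : uniq (seg p) by move: un; rewrite !cat_uniq => /and4P[_ _ ->].
  by rewrite /= inE andbT.
have pp := paired_same_name wf m1 m2 en ne.
have ek := paired_key pp en; have [c1 c2] := andP pc.
have eo := paired_over pp c1.
have ef : flat (seg p) = [:: key p.1; bar (key p.1)] by rewrite flat_seg // ek.
rewrite /Fword !flat_cat !over_keys_cat ef; rewrite !flat_cat ef in wfk.
apply: (@Fflat_monogon _ _ _ _ _ _ (if is_over p.1 then key p.1 else key p.2) wfk).
- by move=> x; rewrite -over_keys_cat -flat_cat => /over_keys_sub.
- by case: ifP => _; rewrite ?ek; [left|right].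
- have -> : over_keys (seg p) = [:: if is_over p.1 then key p.1 else key p.2].
    by rewrite /over_keys /= eo; case: (is_over p.1).
  by rewrite perm_sym perm_catCA.
Qed.

Lemma perm_ins3 (T : eqType) (s s' u v w : seq T) : perm_eq s s' ->
  perm_eq (s ++ u ++ v ++ w) (u ++ [::] ++ v ++ s' ++ w).
Proof.
move=> p; apply/permP => a; rewrite !count_cat (permP p) /=; lia.
Qed.

Lemma Fword_bigon n u v w p q : well_formed (u ++ seg p ++ v ++ seg q ++ w) ->
  well_formed (u ++ v ++ w) -> bigon p q ->
  (both is_over p || both is_over q) || (both is_virt p && both is_virt q) ->
  Fword n (u ++ seg p ++ v ++ seg q ++ w) = Fword n (u ++ v ++ w).
Proof.
move=> wf wf0 bp; case/orP=> [pqo|/andP[/both_virt[f o] /both_virt[f' o']]]; last first.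
  by apply: Fword_flat; rewrite ?flat_cat ?over_keys_cat ?f ?o ?f' ?o'.
set W := u ++ _ in wf *.
have un : uniq (seg p ++ seg q).
  apply: subseq_uniq (well_formed_uniq wf).
  rewrite -[seg p ++ _]/([::] ++ seg p ++ [::] ++ seg q ++ [::]).
  by rewrite !cat_subseq ?sub0seq ?subseq_refl.
have sub x : x \in seg p ++ seg q -> x \in W.
  by rewrite /W !mem_cat => /orP[] ->; rewrite ?orbT.
have dis x y : x \in seg p -> y \in seg q -> name x = name y ->
    paired x y /\ key y = bar (key x).
  move=> xp yq e; have pxy : paired x y.
    apply: (paired_same_name wf); rewrite ?sub ?mem_cat ?xp ?yq ?orbT //.
    move: un; rewrite cat_uniq => /and3P[_ /hasPn /(_ y yq) + _].
    by apply: contraNneq => <-.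
  by split=> //; apply: paired_key.
case: bp => d [e [/andP[/eqP n1 /eqP l1] /andP[/eqP n2 /eqP l2]]].
have fp b s : finish b s \in seg s by case: b; rewrite !inE eqxx ?orbT.
have sp b s : start b s \in seg s by case: b; rewrite !inE eqxx ?orbT.
have [pr1 k1] := dis _ _ (fp d p) (sp e q) n1.
have [pr2 k2] := dis _ _ (sp d p) (fp e q) (esym n2).
have cls : is_classical p.1 /\ is_classical p.2 /\ is_classical q.1 /\ is_classical q.2.
  have := paired_classical pr1; have := paired_classical pr2.
  case/orP: pqo => /andP[/over_classical o1 /over_classical o2].
    by case: (d) (e) => [] [] /=; rewrite o1 o2.
  by case: (d) (e) => [] [] /=; rewrite o1 o2.
have [c1 [c2 [c3 c4]]] := cls.
have fq : flat (seg q) = ord2 (d (+) e) (bar (key p.1)) (bar (key p.2)).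
  rewrite flat_seg /both ?c3 //.
  by move: k1 k2; case: (d) (e) => [] [] /= -> ->.
have fpp : flat (seg p) = [:: key p.1; key p.2] by rewrite flat_seg /both ?c1.
have ne : (key p.1).2 != (key p.2).2.
  have := paired_ltr pr2; rewrite l2; move: l1.
  by case: (d) (e) => [] [] /=; case: (ltr p.1) (ltr p.2) => [] [].
have wfk := flat_wf_flat wf; have wfk0 := flat_wf_flat wf0.
rewrite /Fword /W !flat_cat !over_keys_cat fpp fq.
rewrite /W !flat_cat fpp fq in wfk; rewrite !flat_cat in wfk0.
apply: (Fflat_bigon _ wfk wfk0 ne).
  by move=> x; rewrite -!over_keys_cat -!flat_cat => /over_keys_sub.
have opp : forall x y, x \in seg p -> paired x y -> is_over y = ~~ is_over x.
  move=> x y; rewrite !inE => xp pxy; apply: (paired_over pxy).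
  by case/orP: xp => /eqP ->.
have op1 := opp _ _ (fp d p) pr1; have op2 := opp _ _ (sp d p) pr2.
case: (boolP (both is_over p)) pqo => /= [/andP[o1 o2] _|_ /andP[o1 o2]].
- left; have [u1 u2] : is_over q.1 = false /\ is_over q.2 = false.
    by move: op1 op2; case: (d) (e) => [] [] /= -> ->; rewrite ?o1 ?o2.
  have -> : over_keys (seg p) = [:: key p.1; key p.2] by rewrite /over_keys /= o1 o2.
  have -> : over_keys (seg q) = [::] by rewrite /over_keys /= u1 u2.
  by rewrite perm_sym perm_catCA.
- right; have [u1 u2] : is_over p.1 = false /\ is_over p.2 = false.
    by move: op1 op2; case: (d) (e) => [] [] /=; rewrite ?o1 ?o2;
      move=> /esym/negbTE -> /esym/negbTE ->.
  have -> : over_keys (seg p) = [::] by rewrite /over_keys /= u1 u2.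
  have -> : over_keys (seg q) = ord2 (d (+) e) (bar (key p.1)) (bar (key p.2)).
    by rewrite -fq /over_keys /flat /= o1 o2 c3 c4.
  apply: (@perm_ins3 _ [:: bar (key p.1); bar (key p.2)]).
  exact: (@perm_ord2 _ true).
Qed.

(** The segments [p], [q], [r] are the strands of a triangle of the flat word. *)
Definition tri_keys (p q r : letter * letter) : Prop :=
  exists oA oB oC a b c, [/\ tri oA oB oC a b c,
    flat (seg p) = ord2 oA a (bar c),
    flat (seg q) = ord2 oB b (bar a) &
    flat (seg r) = ord2 oC c (bar b)].

(** The notion does not depend on the cyclic order of the strands around the face. *)
Lemma tri_keys_sym p q r : tri_keys p r q -> tri_keys p q r.
Proof.
move=> [oA [oB [oC [a [b [c [/and5P[ab bc ca t1 t2] f1 f2 f3]]]]]]].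
exists (~~ oA), (~~ oC), (~~ oB), (bar c), (bar b), (bar a).
split; rewrite ?f1 ?f2 ?f3 ?barK; try exact: ord2_sym.
rewrite /tri /= [c.1 == _]eq_sym bc [b.1 == _]eq_sym ab [a.1 == _]eq_sym ca /=.
move: t1 t2; rewrite !addbN !addNb !negbK.
by move=> /eqP -> /eqP ->; rewrite eqxx.
Qed.

Lemma flips_disjoint w u v z t p q r : well_formed w ->
  w = u ++ seg p ++ v ++ seg q ++ z ++ seg r ++ t ->
  uniq (seg p ++ seg q ++ seg r) /\ {subset seg p ++ seg q ++ seg r <= w}.
Proof.
move=> wf e; have h : subseq (seg p ++ seg q ++ seg r) w.
  rewrite e -[X in subseq X _]/([::] ++ seg p ++ [::] ++ seg q ++ [::] ++ seg r ++ [::]).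
  by rewrite !cat_subseq ?sub0seq ?subseq_refl.
split; first exact: subseq_uniq h (well_formed_uniq wf).
exact: mem_subseq.
Qed.

Lemma finish_start_seg b s : finish b s \in seg s /\ start b s \in seg s.
Proof. by case: b; rewrite !inE !eqxx ?orbT. Qed.

(** A corner is a double point through which both segments pass; the equality of
    names gives paired letters since the segments are at different places. *)
Lemma corner_paired w d e p q : well_formed w -> {subset seg p ++ seg q <= w} ->
  uniq (seg p ++ seg q) -> corner d e p q ->
  [/\ paired (finish d p) (start e q), key (start e q) = bar (key (finish d p)) &
      (key (finish d p)).2 = (d == e)].
Proof.
move=> wf sub un /andP[/eqP en /eqP l].
have [fp _] := finish_start_seg d p; have [_ sq] := finish_start_seg e q.
have pr : paired (finish d p) (start e q).
  apply: (paired_same_name wf); rewrite ?sub ?mem_cat ?fp ?sq ?orbT //.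
  move: un; rewrite cat_uniq => /and3P[_ /hasPn /(_ _ sq) + _].
  by apply: contraNneq => <-.
by split=> //; apply: paired_key.
Qed.

Lemma flat_seg_ord2 b s : both is_classical s ->
  flat (seg s) = ord2 (~~ b) (key (finish b s)) (key (start b s)).
Proof. by move=> h; rewrite flat_seg //; case: b. Qed.

Lemma seg_pairs (w : seq letter) p q r : uniq (seg p ++ seg q ++ seg r) ->
  {subset seg p ++ seg q ++ seg r <= w} ->
  [/\ {subset seg p ++ seg q <= w} /\ uniq (seg p ++ seg q),
      {subset seg q ++ seg r <= w} /\ uniq (seg q ++ seg r) &
      {subset seg r ++ seg p <= w} /\ uniq (seg r ++ seg p)].
Proof.
move=> un sub.
have pair (x y z : letter * letter) :
    perm_eq (seg p ++ seg q ++ seg r) (seg x ++ seg y ++ seg z) ->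
    {subset seg x ++ seg y <= w} /\ uniq (seg x ++ seg y).
  move=> pm; split.
    by move=> t tin; apply: sub; rewrite (perm_mem pm) catA mem_cat tin.
  by move: un; rewrite (perm_uniq pm) catA cat_uniq => /and3P[].
split; first exact: (pair p q r).
  by apply: (pair q r p); rewrite perm_catC catA.
by apply: (pair r p q); rewrite catA perm_catC.
Qed.

Lemma triangle_keys w p q r : well_formed w ->
  uniq (seg p ++ seg q ++ seg r) -> {subset seg p ++ seg q ++ seg r <= w} ->
  [&& both is_classical p, both is_classical q & both is_classical r] ->
  triangle p q r -> tri_keys p q r.
Proof.
move=> wf un sub /and3P[pc qc rc] [d [e [f [c1 c2 c3]]]].
have [[s1 u1] [s2 u2] [s3 u3]] := seg_pairs un sub.
have [_ k1 l1] := corner_paired wf s1 u1 c1.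
have [_ k2 l2] := corner_paired wf s2 u2 c2.
have [_ k3 l3] := corner_paired wf s3 u3 c3.
set a := key (finish d p) in k1 l1; set b := key (finish e q) in k2 l2.
set c := key (finish f r) in k3 l3.
have fp : flat (seg p) = ord2 (~~ d) a (bar c) by rewrite (flat_seg_ord2 d) // -k3.
have fq : flat (seg q) = ord2 (~~ e) b (bar a) by rewrite (flat_seg_ord2 e) // -k1.
have fr : flat (seg r) = ord2 (~~ f) c (bar b) by rewrite (flat_seg_ord2 f) // -k2.
have unk : uniq (flat (seg p) ++ flat (seg q) ++ flat (seg r)).
  rewrite -!flat_cat map_inj_in_uniq ?filter_uniq // => x y.
  rewrite !mem_filter => /andP[_ /sub xw] /andP[_ /sub yw].
  exact: key_inj xw yw.
have : uniq [:: a; bar c; b; bar a; c; bar b].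
  move: unk; rewrite fp fq fr; have pm : perm_eq
    (ord2 (~~ d) a (bar c) ++ ord2 (~~ e) b (bar a) ++ ord2 (~~ f) c (bar b))
    [:: a; bar c; b; bar a; c; bar b].
    apply: (@perm_cat _ _ [:: a; bar c] _ [:: b; bar a; c; bar b]).
      exact: (@perm_ord2 _ _ true).
    apply: (@perm_cat _ _ [:: b; bar a] _ [:: c; bar b]); exact: (@perm_ord2 _ _ true).
  by rewrite (perm_uniq pm).
rewrite /= !inE !negb_or.
case/and5P=> /and5P[_ n2 _ n4 n5] /and4P[m1 _ _ _] /and3P[_ q2 _] /andP[r1 _] _.
exists (~~ d), (~~ e), (~~ f), a, b, c; split=> //.
rewrite /tri !eq_name !negb_or l1 l2 l3 n2 n5 q2 [b == bar c]eq_sym m1.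
rewrite [c == a]eq_sym n4 [c == bar a]eq_sym r1 /=.
by case: (d) (e) (f) => [] [] [].
Qed.

Lemma Fword_flips n u v w z p q r :
  let W a b c := u ++ seg a ++ v ++ seg b ++ w ++ seg c ++ z in
  well_formed (W p q r) -> triangle p q r \/ triangle p r q ->
  [&& both is_classical p, both is_classical q & both is_classical r] ->
  Fword n (W (swap p) (swap q) (swap r)) = Fword n (W p q r).
Proof.
move=> W wf t cl; have wfk := flat_wf_flat wf.
have [un sub] := flips_disjoint wf (erefl _).
have [oA [oB [oC [a [b [c [tr fp fq fr]]]]]]] : tri_keys p q r.
  case: t => t; first exact: triangle_keys wf un sub cl t.
  have pm : perm_eq (seg p ++ seg q ++ seg r) (seg p ++ seg r ++ seg q).
    by rewrite perm_cat2l perm_catC.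
  have un' : uniq (seg p ++ seg r ++ seg q) by rewrite -(perm_uniq pm).
  have sub' : {subset seg p ++ seg r ++ seg q <= W p q r}.
    by move=> x; rewrite -(perm_mem pm); apply: sub.
  apply: tri_keys_sym; apply: (triangle_keys wf un' sub') => //.
  by case/and3P: cl => -> -> ->.
have swapE o x y s : flat (seg s) = ord2 o x y -> flat (seg (swap s)) = ord2 (~~ o) x y.
  by move=> e; rewrite -rev_ord2 -e -flat_rev.
have ovE s : perm_eq (over_keys (seg s)) (over_keys (seg (swap s))).
  by apply: perm_map; apply: perm_filter; rewrite (perm_catC [:: s.1] [:: s.2]).
rewrite /Fword /W !flat_cat !over_keys_cat fp fq fr.
rewrite (swapE _ _ _ _ fp) (swapE _ _ _ _ fq) (swapE _ _ _ _ fr).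
rewrite /W !flat_cat fp fq fr in wfk.
apply: (Fflat_tri _ tr wfk).
- move=> x; rewrite -fp -fq -fr -!over_keys_cat -!flat_cat; exact: over_keys_sub.
- by rewrite !perm_cat // ovE.
Qed.

(** At least one of the two passages is virtual, so that exchanging them does not
    change the flat word. *)
Definition half_virt (s : letter * letter) : bool := is_virt s.1 || is_virt s.2.

Lemma half_virt_swap s : half_virt s ->
  flat (seg (swap s)) = flat (seg s) /\ over_keys (seg (swap s)) = over_keys (seg s).
Proof.
rewrite /half_virt /flat /over_keys /= /is_virt /is_classical /is_over.
by case: (lev s.1) (lev s.2) => [] [].
Qed.

Lemma Fword_flips_virt n u v w z p q r :
  half_virt p -> half_virt q -> half_virt r ->
  Fword n (u ++ seg (swap p) ++ v ++ seg (swap q) ++ w ++ seg (swap r) ++ z) =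
  Fword n (u ++ seg p ++ v ++ seg q ++ w ++ seg r ++ z).
Proof.
move=> /half_virt_swap[f1 o1] /half_virt_swap[f2 o2] /half_virt_swap[f3 o3].
by apply: Fword_flat; rewrite !(flat_cat, over_keys_cat) ?f1 ?f2 ?f3 ?o1 ?o2 ?o3.
Qed.

Lemma corner_half_virt w d e p q : well_formed w -> {subset seg p ++ seg q <= w} ->
  uniq (seg p ++ seg q) -> corner d e p q ->
  (both is_virt p -> half_virt q) /\ (both is_virt q -> half_virt p).
Proof.
move=> wf sub un c; have [pr _ _] := corner_paired wf sub un c.
have es : is_virt (start e q) = is_virt (finish d p).
  by have := paired_classical pr; rewrite /is_virt /is_classical => /negb_inj.
rewrite /half_virt /both; split=> /andP[v1 v2].
  have : is_virt (start e q) by rewrite es; case: (d).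
  by case: (e) => /= ->; rewrite ?orbT.
have : is_virt (finish d p) by rewrite -es; case: (e).
by case: (d) => /= ->; rewrite ?orbT.
Qed.

(** A virtual strand makes two of the three double points virtual, and every strand
    passes through one of them. *)
Lemma triangle_half_virt w p q r : well_formed w ->
  uniq (seg p ++ seg q ++ seg r) -> {subset seg p ++ seg q ++ seg r <= w} ->
  triangle p q r -> [|| both is_virt p, both is_virt q | both is_virt r] ->
  [/\ half_virt p, half_virt q & half_virt r].
Proof.
move=> wf un sub [d [e [f [c1 c2 c3]]]].
have [[s1 u1] [s2 u2] [s3 u3]] := seg_pairs un sub.
have [pq qp] := corner_half_virt wf s1 u1 c1.
have [qr rq] := corner_half_virt wf s2 u2 c2.
have [rp pr] := corner_half_virt wf s3 u3 c3.
have self s : both is_virt s -> half_virt s by case/andP=> v1 _; rewrite /half_virt v1.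
by case/or3P => h; split; auto.
Qed.

Lemma Fword_flips_half n u v w z p q r :
  let W a b c := u ++ seg a ++ v ++ seg b ++ w ++ seg c ++ z in
  well_formed (W p q r) -> triangle p q r \/ triangle p r q ->
  [|| both is_virt p, both is_virt q | both is_virt r] ->
  Fword n (W (swap p) (swap q) (swap r)) = Fword n (W p q r).
Proof.
move=> W wf t vi; have [un sub] := flips_disjoint wf (erefl _).
have [hp hq hr] : [/\ half_virt p, half_virt q & half_virt r].
  case: t => t; first exact: triangle_half_virt wf un sub t vi.
  have pm : perm_eq (seg p ++ seg q ++ seg r) (seg p ++ seg r ++ seg q).
    by rewrite perm_cat2l perm_catC.
  have un' : uniq (seg p ++ seg r ++ seg q) by rewrite -(perm_uniq pm).
  have sub' : {subset seg p ++ seg r ++ seg q <= W p q r}.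
    by move=> x; rewrite -(perm_mem pm); apply: sub.
  have [|//] := triangle_half_virt wf un' sub' t.
  by case/or3P: vi => ->; rewrite ?orbT.
exact: Fword_flips_virt.
Qed.

Lemma Fpoly_move n D D' : move D D' -> Fpoly n D' = Fpoly n D.
Proof.
rewrite !FpolyE -!/(Fword n _).
have wf := word_well_formed D; have wf' := word_well_formed D'.
have mono p : adds_monogon p D D' -> both is_classical p || both is_virt p ->
    Fword n (word D') = Fword n (word D).
  case=> m [_ [u [v [e e']]]]; rewrite e e' => h; apply: Fword_monogon => //.
  by rewrite -e'.
have bi p q : adds_bigon p q D D' ->
    (both is_over p || both is_over q) || (both is_virt p && both is_virt q) ->
    Fword n (word D') = Fword n (word D).
  case=> m [_ [u [v [w [e e']]]]]; rewrite e e' => h; apply: Fword_bigon => //.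
    by rewrite -e'.
  by rewrite -e.
have flips p q r : flips_triangle p q r D D' ->
    [&& both is_classical p, both is_classical q & both is_classical r] ||
    [|| both is_virt p, both is_virt q | both is_virt r] ->
    Fword n (word D') = Fword n (word D).
  case=> t [_ [u [v [w [z [e e']]]]]]; rewrite e e' => /orP[] h.
    by apply: Fword_flips => //; rewrite -e.
  by apply: Fword_flips_half => //; rewrite -e.
case=> [f fi -> _|b e _ -> _|p h c|p q h c|p q r h c _|p h c|p q h c|p q r h c|p q r h c].
- exact: Fword_rename.
- exact: Fword_rot.
- by apply: (mono p h); rewrite c.
- by apply: (bi p q h); rewrite c.
- by apply: (flips p q r h); rewrite c.
- by apply: (mono p h); rewrite c orbT.
- by apply: (bi p q h); rewrite c orbT.
- by apply: (flips p q r h); case/and3P: c => ->; rewrite !orbT.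
- by apply: (flips p q r h); apply/orP; right; case/or3P: c => /andP[-> _]; rewrite ?orbT.
Qed.

Local Close Scope ring_scope.

Theorem theorem6p4 (n : nat) (D D' : diagram) (hn : 0 < n)
  (hDD' : same_virtual_knot D D') : Fpoly n D = Fpoly n D'.
Proof.
elim: hDD' => {hn D D'} [D D' /Fpoly_move -> //|//|D D' _ -> //|D1 D2 D3 _ -> _ -> //].
Qed.
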